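(* Let $\gamma$ be a smooth simple closed curve in the affine plane with strictly positive equi-affine curvature $\kappa$. Then each of the following holds: (i) $\gamma$ is a critical point of $\int\sqrt{\kappa}\,\mathrm{d}s$ if and only if $\gamma$ is an ellipse; (ii) $\gamma$ is a critical point of $\int\sqrt{\kappa}\,\mathrm{d}s$ under area constraint if and only if $\gamma$ is an ellipse; (iii) $\gamma$ is a critical point of $\int\sqrt{\kappa}\,\mathrm{d}s$ under equi-affine arc-length constraint if and only if $\gamma$ is an ellipse; (iv) $\gamma$ is a critical point of $\int\sqrt{\kappa}\,\mathrm{d}s$ under total equi-affine curvature constraint if and only if $\gamma$ is an ellipse. (That is, among simple closed strictly positively curved curves, the ellipses are the only critical points in each of these four variational problems.)
   Context: The affine plane is $\mathbb{R}^2$ with area form $|u,v|=\det(u,v)$. The curve is parametrised by equi-affine arc-length $s$ ($|\gamma',\gamma''|=1$); the equi-affine curvature is defined by $\gamma'''=-\kappa\gamma'$, and strictly positively curved means $\kappa>0$. Variations are smooth variations of the closed curve within strictly positively curved curves; for a variation with vector field $fN+gT$ ($T=\gamma'$, $N=\gamma''$) the enclosed area changes to first order by $\delta\,\mathrm{Area}=-\int f\,\mathrm{d}s$. A critical point of $\int\sqrt{\kappa}\,\mathrm{d}s$ under the constraint of a functional $G$ (area, total equi-affine arc-length $\int\mathrm{d}s$, or total equi-affine curvature $\int\kappa\,\mathrm{d}s$) means there exists a constant $\lambda$ with $\delta\int\sqrt{\kappa}\,\mathrm{d}s=\lambda\,\delta G$ for all variations; an (unconstrained) critical point means $\delta\int\sqrt{\kappa}\,\mathrm{d}s=0$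 for all variations. *)

(* Defs.v *)
From Stdlib Require Import Reals List.
From Coquelicot Require Import Coquelicot.
Open Scope R_scope.

Definition smooth1 (f : R -> R) : Prop :=
  forall (n : nat) (x : R), ex_derive (Derive_n f n) x.

Fixpoint pd (w : list bool) (f : R -> R -> R) : R -> R -> R :=
  match w with
  | nil => f
  | b :: w' =>
      if b then fun t u => Derive (fun t' => pd w' f t' u) t
      else fun t u => Derive (fun u' => pd w' f t u') u
  end.

Definition smooth2 (f : R -> R -> R) : Prop :=
  forall (w : list bool) (t u : R),
    ex_derive (fun t' => pd w f t' u) t /\
    ex_derive (fun u' => pd w f t u') u /\
    continuous (fun p : R * R => pd w f (fst p) (snd p)) (t, u).

(** Equi-affine quantities of a curve c = (X,Y) in an arbitrary regular
    parametrisation u with phi = |c',c''| > 0: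
    ds = phi^(1/3) du, d/ds = phi^(-1/3) d/du,
    T = c_s, N = T_s, and kappa = |N, N_s| (for an equi-affine arc-length
    parametrisation this is exactly the kappa of c''' = -kappa c'). *)
Definition aphi (X Y : R -> R) (u : R) : R :=
  Derive X u * Derive (Derive Y) u - Derive Y u * Derive (Derive X) u.
Definition ads (X Y : R -> R) (u : R) : R := Rpower (aphi X Y u) (1/3).
Definition aTx (X Y : R -> R) (u : R) : R := Derive X u / ads X Y u.
Definition aTy (X Y : R -> R) (u : R) : R := Derive Y u / ads X Y u.
Definition aNx (X Y : R -> R) (u : R) : R := Derive (aTx X Y) u / ads X Y u.
Definition aNy (X Y : R -> R) (u : R) : R := Derive (aTy X Y) u / ads X Y u.
Definition akappa (X Y : R -> R) (u : R) : R :=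
  (aNx X Y u * Derive (aNy X Y) u - aNy X Y u * Derive (aNx X Y) u) / ads X Y u.

Definition pos_curved (X Y : R -> R) : Prop :=
  forall u, 0 < aphi X Y u /\ 0 < akappa X Y u.

Definition F_sqrtk (L : R) (X Y : R -> R) : R :=
  RInt (fun u => sqrt (akappa X Y u) * ads X Y u) 0 L.
Definition F_area (L : R) (X Y : R -> R) : R :=
  / 2 * RInt (fun u => X u * Derive Y u - Y u * Derive X u) 0 L.
Definition F_length (L : R) (X Y : R -> R) : R :=
  RInt (fun u => ads X Y u) 0 L.
Definition F_totcurv (L : R) (X Y : R -> R) : R :=
  RInt (fun u => akappa X Y u * ads X Y u) 0 L.

Definition variation (L : R) (X Y : R -> R) (GX GY : R -> R -> R) : Prop :=
  smooth2 GX /\ smooth2 GY /\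
  (forall u, GX 0 u = X u /\ GY 0 u = Y u) /\
  (forall t u, GX t (u + L) = GX t u /\ GY t (u + L) = GY t u) /\
  (exists eps, 0 < eps /\ forall t, Rabs t < eps -> pos_curved (GX t) (GY t)).

Definition first_var (F : (R -> R) -> (R -> R) -> R) (GX GY : R -> R -> R) : R :=
  Derive (fun t => F (GX t) (GY t)) 0.

Definition critical (L : R) (F : (R -> R) -> (R -> R) -> R) (X Y : R -> R) : Prop :=
  forall GX GY, variation L X Y GX GY -> first_var F GX GY = 0.

Definition critical_under (L : R) (F G : (R -> R) -> (R -> R) -> R)
  (X Y : R -> R) : Prop :=
  exists lambda : R, forall GX GY, variation L X Y GX GY ->
    first_var F GX GY = lambda * first_var G GX GY.

Definition is_ellipse (X Y : R -> R) : Prop :=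
  exists a b c d e f : R, a * d - b * c <> 0 /\
    (forall s, exists th, X s = a * cos th + b * sin th + e /\
                          Y s = c * cos th + d * sin th + f) /\
    (forall th, exists s, X s = a * cos th + b * sin th + e /\
                          Y s = c * cos th + d * sin th + f).

Definition simple_closed (L : R) (X Y : R -> R) : Prop :=
  0 < L /\
  (forall s, X (s + L) = X s /\ Y (s + L) = Y s) /\
  (forall s1 s2, 0 <= s1 < L -> 0 <= s2 < L -> X s1 = X s2 -> Y s1 = Y s2 -> s1 = s2).

Definition equiaffine_arclength (X Y : R -> R) : Prop :=
  forall s, Derive X s * Derive_n Y 2 s - Derive Y s * Derive_n X 2 s = 1.

Definition strictly_pos_curved_al (X Y : R -> R) : Prop :=
  exists kappa : R -> R, (forall s, 0 < kappa s) /\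
    forall s, Derive_n X 3 s = - kappa s * Derive X s /\
              Derive_n Y 3 s = - kappa s * Derive Y s.

(* Main.v *)
Require Import Defs.
From Stdlib Require Import Reals ZArith Lra Lia List FunctionalExtensionality.
From Stdlib Require Import Ranalysis5 ClassicalEpsilon.
From Coquelicot Require Import Coquelicot.
Open Scope R_scope.

(* Write [p = kappa^(-1/2)]. For a variation with normal part [f N] the first variation of the
   integral of [sqrt kappa] is one sixth of the integral of [(p'''' + kappa p'') f]. Testing with
   [f = p^2] leaves, up to exact derivatives, [2 p p''^2], so an unconstrained critical curve has
   constant curvature and is an ellipse; conversely, for constant curvature the first variation is
   the integral of an exact derivative. The constraints play no role: the integral of [sqrt kappa] is
   invariant under dilations, while area, length and total curvature scale with a nonzero exponent,
   so the multiplier vanishes as soon as the constraint functional is nonzero. For the area this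
   requires that a simple closed, locally convex curve be convex. *)

(** * Smooth functions and the curvature integrand in terms of jets *)

(** The test field is dictated by the denominator: since [kappa = p^-2], the factor [p^2] turns
    [kappa p''] into the exact derivative [p''], and two integrations by parts turn [p^2 p''''] into
    [2 p'^2 p'' + 2 p p''^2], whose first summand is the derivative of [2/3 p'^3]. No Euler-Lagrange
    operator for a general [f] is formed: the integrand is linearised in the derivatives of an
    arbitrary field, tangential part included, so for constant curvature exactness holds without
    splitting the field. The linearisation stays manageable because [sqrt kappa ds = sqrt q du] with
    [q] rational in the derivatives of the curve: the fractional powers of [|c', c''|] cancel. The
    area needs a global argument. Instead of the exact turning number, only the bound [2 PI] on the
    turning of the tangent over one period is proved, which already puts the curve on one side of
    each tangent. *)

Lemma is_derive_Rplus (f g : R -> R) (x a b : R) :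
  is_derive f x a -> is_derive g x b -> is_derive (fun t => f t + g t) x (a + b).
Proof. intros Hf Hg. exact (is_derive_plus f g x a b Hf Hg). Qed.

Lemma is_derive_Rminus (f g : R -> R) (x a b : R) :
  is_derive f x a -> is_derive g x b -> is_derive (fun t => f t - g t) x (a - b).
Proof. intros Hf Hg. exact (is_derive_minus f g x a b Hf Hg). Qed.

Lemma is_derive_Rmult (f g : R -> R) (x a b : R) :
  is_derive f x a -> is_derive g x b ->
  is_derive (fun t => f t * g t) x (a * g x + f x * b).
Proof. intros Hf Hg. exact (is_derive_mult f g x a b Hf Hg Rmult_comm). Qed.

Lemma is_derive_eq (f : R -> R) (x a b : R) : is_derive f x a -> a = b -> is_derive f x b.
Proof. now intros H <-. Qed.

Ltac rewrite_Derives :=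
  repeat match goal with
  | |- context [Derive ?f ?x] => erewrite (is_derive_unique f x) by eauto
  end.

Lemma smooth1_Derive_n (f : R -> R) (n : nat) (x : R) :
  smooth1 f -> is_derive (Derive_n f n) x (Derive_n f (S n) x).
Proof. intros Hf. apply Derive_correct, Hf. Qed.

Lemma smooth1_Derive (f : R -> R) : smooth1 f -> smooth1 (Derive f).
Proof.
  intros Hf n x.
  apply ex_derive_ext with (Derive_n f (S n)); [|apply Hf].
  intros t. replace (S n) with (n + 1)%nat by lia.
  symmetry. apply (Derive_n_comp f n 1 t).
Qed.

(** Polynomials in [p] with smooth coefficients: a class closed under differentiation as soon as it
    contains [p'], which spares a Leibniz formula for higher derivatives. *)
Inductive poly_in (p : R -> R) : (R -> R) -> Prop :=
| poly_in_smooth f : smooth1 f -> poly_in p f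
| poly_in_var : poly_in p p
| poly_in_plus f g : poly_in p f -> poly_in p g -> poly_in p (fun x => f x + g x)
| poly_in_mult f g : poly_in p f -> poly_in p g -> poly_in p (fun x => f x * g x).

Lemma smooth1_poly_in (p dp : R -> R) :
  (forall x, is_derive p x (dp x)) -> poly_in p dp ->
  forall f, poly_in p f -> smooth1 f.
Proof.
  intros Hp Hdp.
  assert (step : forall f, poly_in p f ->
            (forall x, ex_derive f x) /\ poly_in p (Derive f)).
  { induction 1 as [f Hf| |f g _ [Ef IHf] _ [Eg IHg]|f g Pf [Ef IHf] Pg [Eg IHg]].
    - split; [exact (Hf 0%nat)|]. now apply poly_in_smooth, smooth1_Derive.
    - split; [intros x; now exists (dp x)|].
      replace (Derive p) with dp; auto.
      extensionality x. symmetry. now apply is_derive_unique.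
    - split; [intros x; exists (Derive f x + Derive g x); apply is_derive_Rplus; now apply Derive_correct|].
      replace (Derive _) with (fun x => Derive f x + Derive g x);
        [now apply poly_in_plus|].
      extensionality x. symmetry. now apply Derive_plus.
    - split; [intros x; now apply ex_derive_mult|].
      replace (Derive _) with (fun x => Derive f x * g x + f x * Derive g x);
        [now apply poly_in_plus; apply poly_in_mult|].
      extensionality x. symmetry. now apply Derive_mult. }
  intros f Hf n.
  assert (H : poly_in p (Derive_n f n)); [|exact (proj1 (step _ H))].
  induction n as [|n IH]; [exact Hf|exact (proj2 (step _ IH))].
Qed.

Lemma smooth1_const (c : R) : smooth1 (fun _ => c).
Proof.
  assert (H : forall n x, Derive_n (fun _ => c) n x = match n with O => c | S _ => 0 end).
  { induction n as [|n IH]; intros x; [reflexivity|].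
    simpl. rewrite (Derive_ext _ _ x IH). apply Derive_const. }
  intros n x. eapply ex_derive_ext; [intros t; symmetry; apply H|].
  apply ex_derive_const.
Qed.

Lemma smooth1_plus (f g : R -> R) :
  smooth1 f -> smooth1 g -> smooth1 (fun x => f x + g x).
Proof.
  (* The generator [0] is a dummy; sums of smooth functions belong to the class for any
     generator. *)
  intros Hf Hg. apply (smooth1_poly_in (fun _ => 0) (fun _ => 0)).
  - intros x. exact (is_derive_const 0 x).
  - apply poly_in_var.
  - now apply poly_in_plus; apply poly_in_smooth.
Qed.

Lemma smooth1_mult (f g : R -> R) :
  smooth1 f -> smooth1 g -> smooth1 (fun x => f x * g x).
Proof.
  intros Hf Hg. apply (smooth1_poly_in (fun _ => 0) (fun _ => 0)).
  - intros x. exact (is_derive_const 0 x).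
  - apply poly_in_var.
  - now apply poly_in_mult; apply poly_in_smooth.
Qed.

(** With [p = f^(-1/2)] one has [p' = - f' p^3 / 2], again a polynomial in [p] with smooth
    coefficients. *)
Lemma smooth1_inv_sqrt (f : R -> R) :
  smooth1 f -> (forall x, 0 < f x) -> smooth1 (fun x => / sqrt (f x)).
Proof.
  intros Hf Hpos.
  set (p := fun x => / sqrt (f x)).
  apply (smooth1_poly_in p (fun x => (- / 2 * Derive f x) * (p x * (p x * p x)))).
  - intros x. unfold p. assert (Hx := Hpos x).
    assert (Hs := sqrt_lt_R0 _ Hx).
    auto_derive.
    + repeat split; [apply (Hf 0%nat)|exact Hx|lra].
    + rewrite Rinv_mult. assert (sqrt (f x) <> 0) by lra.
      change (Derive (fun y => f y) x) with (Derive f x).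
      field. lra.
  - apply poly_in_mult.
    + apply poly_in_smooth, smooth1_mult;
        [apply smooth1_const|now apply smooth1_Derive].
    + repeat apply poly_in_mult; apply poly_in_var.
  - apply poly_in_var.
Qed.

(** The classical formula for the equi-affine curvature in an arbitrary parametrisation, multiplied
    by [phi^(2/3)]. This factor cancels every fractional power, and [kappa ds^2 = q du^2]. *)
Definition jet_q (x1 y1 x2 y2 x3 y3 x4 y4 : R) : R :=
  (3 * (x1 * y2 - y1 * x2) * (4 * (x2 * y3 - y2 * x3) + (x1 * y4 - y1 * x4))
   - 5 * (x1 * y3 - y1 * x3) ^ 2) / (9 * (x1 * y2 - y1 * x2) ^ 2).

Definition curve_q (X Y : R -> R) (u : R) : R :=
  jet_q (Derive_n X 1 u) (Derive_n Y 1 u) (Derive_n X 2 u) (Derive_n Y 2 u)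
        (Derive_n X 3 u) (Derive_n Y 3 u) (Derive_n X 4 u) (Derive_n Y 4 u).

Lemma ads_pos (X Y : R -> R) (u : R) : 0 < ads X Y u.
Proof. apply exp_pos. Qed.

Lemma ads_cube (X Y : R -> R) (u : R) :
  0 < aphi X Y u -> ads X Y u ^ 3 = aphi X Y u.
Proof.
  intros H. rewrite <- Rpower_pow by apply ads_pos.
  unfold ads. rewrite Rpower_mult.
  replace (1 / 3 * INR 3) with 1 by (simpl; field). now apply Rpower_1.
Qed.

Lemma akappa_jet (X Y : R -> R) (u : R) :
  smooth1 X -> smooth1 Y -> (forall v, 0 < aphi X Y v) ->
  akappa X Y u = curve_q X Y u / ads X Y u ^ 2.
Proof.
  intros HX HY Hphi.
  set (m := ads X Y).
  set (x1 := Derive_n X 1). set (x2 := Derive_n X 2).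
  set (x3 := Derive_n X 3). set (x4 := Derive_n X 4).
  set (y1 := Derive_n Y 1). set (y2 := Derive_n Y 2).
  set (y3 := Derive_n Y 3). set (y4 := Derive_n Y 4).
  assert (Dx1 : forall v, is_derive x1 v (x2 v)) by (intros; now apply smooth1_Derive_n).
  assert (Dx2 : forall v, is_derive x2 v (x3 v)) by (intros; now apply smooth1_Derive_n).
  assert (Dx3 : forall v, is_derive x3 v (x4 v)) by (intros; now apply smooth1_Derive_n).
  assert (Dy1 : forall v, is_derive y1 v (y2 v)) by (intros; now apply smooth1_Derive_n).
  assert (Dy2 : forall v, is_derive y2 v (y3 v)) by (intros; now apply smooth1_Derive_n).
  assert (Dy3 : forall v, is_derive y3 v (y4 v)) by (intros; now apply smooth1_Derive_n).
  set (phi := fun v => x1 v * y2 v - y1 v * x2 v).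
  assert (Hp : forall v, 0 < phi v) by exact Hphi.
  assert (Hm : forall v, 0 < m v) by (intros; apply ads_pos).
  assert (Hm3 : forall v, m v ^ 3 = phi v) by (intros; now apply ads_cube).
  (* [r = phi' / (3 phi)] is the logarithmic derivative of [ads = phi^(1/3)], and [dr] is the
     derivative of [r]. *)
  set (r := fun v => (x1 v * y3 v - y1 v * x3 v) / (3 * phi v)).
  set (dr := fun v => ((x2 v * y3 v - y2 v * x3 v) + (x1 v * y4 v - y1 v * x4 v)) / (3 * phi v)
                      - (x1 v * y3 v - y1 v * x3 v) ^ 2 / (3 * phi v ^ 2)).
  assert (Dphi : forall v, is_derive phi v (x1 v * y3 v - y1 v * x3 v)).
  { intros v. unfold phi.
    eapply is_derive_eq;
      [apply is_derive_Rminus; apply is_derive_Rmult; auto|ring]. }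
  assert (Dm : forall v, is_derive m v (r v * m v)).
  { intros v.
    apply (is_derive_ext (fun w => exp (1 / 3 * ln (phi w)))); [reflexivity|].
    evar_last.
    - apply (is_derive_comp (K:=R_AbsRing) exp (fun w => 1 / 3 * ln (phi w))); [apply is_derive_exp|].
      apply is_derive_scal.
      apply (is_derive_comp (K:=R_AbsRing) ln phi); [apply is_derive_ln, Hp|apply Dphi].
    - unfold scal; simpl. unfold mult; simpl.
      change (exp (1 / 3 * ln (phi v))) with (m v).
      unfold r. specialize (Hp v). field. lra. }
  assert (Dr : forall v, is_derive r v (dr v)).
  { intros v. unfold r, dr. specialize (Hp v).
    assert (Hphi' := Dphi v).
    auto_derive.
    - repeat split; try (eexists; eauto); lra.
    - rewrite_Derives. field. lra. }
  (* The affine normal is [m^-2 (c'' - r c')]. *)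
  assert (gen_N : forall z1 z2 : R -> R, (forall v, is_derive z1 v (z2 v)) ->
     forall v, Derive (fun w => z1 w / m w) v / m v = (z2 v - r v * z1 v) / m v ^ 2).
  { intros z1 z2 Dz v. specialize (Hm v).
    rewrite (is_derive_unique _ v ((z2 v * m v - z1 v * (r v * m v)) / m v ^ 2)).
    - field. lra.
    - apply is_derive_div; auto. lra. }
  assert (gen_dN : forall z1 z2 z3 : R -> R, (forall v, is_derive z1 v (z2 v)) ->
     (forall v, is_derive z2 v (z3 v)) ->
     forall v, Derive (fun w => (z2 w - r w * z1 w) / m w ^ 2) v =
       ((z3 v - dr v * z1 v - r v * z2 v - 2 * r v * (z2 v - r v * z1 v)) / m v ^ 2)).
  { intros z1 z2 z3 D1 D2 v. specialize (Hm v).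
    apply is_derive_unique. auto_derive.
    - repeat split; try (eexists; eauto). nra.
    - rewrite_Derives. field. lra. }
  assert (Nx : aNx X Y = fun w => (x2 w - r w * x1 w) / m w ^ 2).
  { extensionality v. now apply gen_N. }
  assert (Ny : aNy X Y = fun w => (y2 w - r w * y1 w) / m w ^ 2).
  { extensionality v. now apply gen_N. }
  unfold akappa. rewrite Nx, Ny.
  rewrite (gen_dN x1 x2 x3 Dx1 Dx2 u), (gen_dN y1 y2 y3 Dy1 Dy2 u).
  unfold curve_q, jet_q.
  fold x1 x2 x3 x4 y1 y2 y3 y4 m.
  change (x1 u * y2 u - y1 u * x2 u) with (phi u).
  assert (E : phi u = m u ^ 3) by now rewrite Hm3.
  specialize (Hm u). specialize (Hp u).
  (* This is [|N, N'| / ads]: the part of [N'] proportional to [N] drops out, and only then is [phi]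
     replaced by [ads^3]. *)
  transitivity ((x2 u * y3 u - y2 u * x3 u + dr u * phi u
     - r u * (x1 u * y3 u - y1 u * x3 u) + r u ^ 2 * phi u) / m u ^ 5).
  { unfold phi. field. lra. }
  unfold dr, r. rewrite E. field. lra.
Qed.

(** * Differentiation of the curvature integral along a variation *)

(** In a word for [pd], [true] differentiates in the variation parameter and [false] along the
    curve, the head being applied last. At time 0, [true :: jet k] is, by Schwarz, the [k]-th
    derivative of the variation field. *)
Notation jet k := (repeat false k).

Lemma Derive_n_slice (G : R -> R -> R) (t : R) (k : nat) :
  Derive_n (G t) k = pd (jet k) G t.
Proof.
  induction k as [|k IH]; [reflexivity|].
  extensionality u. simpl. now rewrite IH.
Qed.

Lemma smooth2_slice (G : R -> R -> R) (t : R) : smooth2 G -> smooth1 (G t).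
Proof. intros HG n u. rewrite Derive_n_slice. exact (proj1 (proj2 (HG (jet n) t u))). Qed.

Lemma smooth2_is_derive_t (G : R -> R -> R) (w : list bool) (t u : R) :
  smooth2 G -> is_derive (fun t' => pd w G t' u) t (pd (true :: w) G t u).
Proof. intros HG. apply Derive_correct, (HG w t u). Qed.

Lemma smooth2_is_derive_u (G : R -> R -> R) (w : list bool) (t u : R) :
  smooth2 G -> is_derive (fun u' => pd w G t u') u (pd (false :: w) G t u).
Proof. intros HG. apply (Derive_correct (fun u' => pd w G t u')), (HG w t u). Qed.

Lemma smooth2_continuity_2d (G : R -> R -> R) (w : list bool) (t u : R) :
  smooth2 G -> continuity_2d_pt (pd w G) t u.
Proof. intros HG. apply continuity_2d_pt_filterlim, (HG w t u). Qed.

(** [d_curve_q] produces words [true :: jet k] with the time derivative outermost, whereas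
    differentiating the variation field along the curve puts [false] in front. *)
Lemma pd_swap (G : R -> R -> R) (w : list bool) (t u : R) :
  smooth2 G -> pd (true :: false :: w) G t u = pd (false :: true :: w) G t u.
Proof.
  intros HG. apply (Schwarz (pd w G) t u).
  - apply locally_2d_forall. intros t' u'. repeat split.
    + apply (HG w t' u').
    + apply (HG w t' u').
    + apply (HG (false :: w) t' u').
    + apply (HG (true :: w) t' u').
  - apply (smooth2_continuity_2d G (true :: false :: w)), HG.
  - apply (smooth2_continuity_2d G (false :: true :: w)), HG.
Qed.

Lemma pd_periodic (G : R -> R -> R) (L : R) (w : list bool) :
  smooth2 G -> (forall t u, G t (u + L) = G t u) ->
  forall t u, pd w G t (u + L) = pd w G t u.
Proof.
  intros HG HL. induction w as [|b w IH]; [exact HL|].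
  intros t u. destruct b; simpl.
  - apply Derive_ext. intros t'. apply IH.
  - transitivity (Derive (fun u' => pd w G t (u' + L)) u); [|now apply Derive_ext].
    symmetry. apply is_derive_unique.
    eapply is_derive_eq;
      [apply (is_derive_comp (fun u' => pd w G t u') (fun u' => u' + L))|].
    + apply (smooth2_is_derive_u G w t (u + L) HG).
    + apply is_derive_Rplus; [exact (is_derive_id u)|exact (is_derive_const L u)].
    + transitivity ((1 + 0) * pd (false :: w) G t (u + L)); [reflexivity|].
      rewrite Rplus_0_r. apply Rmult_1_l.
Qed.

(** Every mixed partial is again affine in [t] with smooth coefficients, so induction on the word
    stays inside this family. *)
Lemma smooth2_affine (A B : R -> R) :
  smooth1 A -> smooth1 B -> smooth2 (fun t u => A u + t * B u).
Proof.
  intros HA HB.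
  assert (H : forall w, exists a b, smooth1 a /\ smooth1 b /\
            pd w (fun t u => A u + t * B u) = fun t u => a u + t * b u).
  { induction w as [|c w (a & b & Ha & Hb & E)].
    - now exists A, B.
    - destruct c; simpl; rewrite E.
      + exists b, (fun _ => 0). repeat split; auto using smooth1_const.
        extensionality t. extensionality u. apply is_derive_unique.
        auto_derive; [easy|ring].
      + exists (Derive a), (Derive b). repeat split; auto using smooth1_Derive.
        extensionality t. extensionality u. apply is_derive_unique.
        assert (Da : ex_derive a u) by apply (Ha 0%nat).
        assert (Db : ex_derive b u) by apply (Hb 0%nat).
        auto_derive; [easy|].
        change (Derive (fun x => a x)) with (Derive a).
        change (Derive (fun x => b x)) with (Derive b). ring. }
  intros w t u. destruct (H w) as (a & b & Ha & Hb & E). rewrite E.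
  assert (Da : ex_derive a u) by apply (Ha 0%nat).
  assert (Db : ex_derive b u) by apply (Hb 0%nat).
  repeat split.
  - auto_derive. easy.
  - auto_derive. easy.
  - apply continuity_2d_pt_filterlim with (f := fun t u => a u + t * b u).
    repeat first [apply continuity_2d_pt_plus | apply continuity_2d_pt_mult
                 | apply continuity_2d_pt_id1];
    apply (continuity_1d_2d_pt_comp _ (fun _ v => v));
     try apply continuity_2d_pt_id2;
    apply continuity_pt_filterlim, (ex_derive_continuous (V:=R_NormedModule)); assumption.
Qed.

Lemma pd_t_affine (A B : R -> R) (k : nat) (t u : R) :
  smooth1 A -> smooth1 B ->
  pd (true :: jet k) (fun t u => A u + t * B u) t u = Derive_n B k u.
Proof.
  intros HA HB.
  assert (E : forall k t u, pd (jet k) (fun t u => A u + t * B u) t u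
                = Derive_n A k u + t * Derive_n B k u).
  { induction k0 as [|j IH]; intros s v; [reflexivity|].
    transitivity (Derive (fun v' => Derive_n A j v' + s * Derive_n B j v') v).
    - apply Derive_ext. intros v'. apply IH.
    - apply is_derive_unique.
      apply is_derive_Rplus; [now apply smooth1_Derive_n|].
      apply is_derive_scal. now apply smooth1_Derive_n. }
  simpl. apply is_derive_unique.
  apply (is_derive_ext (fun t' => Derive_n A k u + t' * Derive_n B k u)).
  - intros t'. now rewrite E.
  - auto_derive; [easy|ring].
Qed.

Definition pdet (GX GY : R -> R -> R) (v w : list bool) (t u : R) : R :=
  pd v GX t u * pd w GY t u - pd v GY t u * pd w GX t u.

Lemma is_derive_pdet (GX GY : R -> R -> R) (v w : list bool) (t u : R) :
  smooth2 GX -> smooth2 GY ->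
  is_derive (fun t' => pdet GX GY v w t' u) t
    (pdet GX GY (true :: v) w t u + pdet GX GY v (true :: w) t u).
Proof.
  intros HX HY. unfold pdet. eapply is_derive_eq.
  - apply is_derive_Rminus; apply is_derive_Rmult; now apply smooth2_is_derive_t.
  - unfold pdet. ring.
Qed.

Lemma continuity_2d_pdet (GX GY : R -> R -> R) (v w : list bool) (t u : R) :
  smooth2 GX -> smooth2 GY -> continuity_2d_pt (pdet GX GY v w) t u.
Proof.
  intros HX HY.
  apply continuity_2d_pt_minus; apply continuity_2d_pt_mult;
    now apply smooth2_continuity_2d.
Qed.

Lemma aphi_slice (GX GY : R -> R -> R) (t u : R) :
  aphi (GX t) (GY t) u = pdet GX GY (jet 1) (jet 2) t u.
Proof. reflexivity. Qed.

Lemma curve_q_slice (GX GY : R -> R -> R) (t u : R) :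
  let phi := pdet GX GY (jet 1) (jet 2) t u in
  let a := 4 * pdet GX GY (jet 2) (jet 3) t u + pdet GX GY (jet 1) (jet 4) t u in
  let c := pdet GX GY (jet 1) (jet 3) t u in
  curve_q (GX t) (GY t) u = (3 * phi * a - 5 * c * c) / (9 * phi * phi).
Proof. unfold curve_q. rewrite !Derive_n_slice. unfold jet_q, pdet. cbv zeta. f_equal; ring. Qed.

(** Trades [akappa], which nests derivatives of fractional powers, for [curve_q], whose joint
    continuity in [t] and [u] is visible. *)
Lemma pos_curved_curve_q (X Y : R -> R) :
  smooth1 X -> smooth1 Y ->
  (pos_curved X Y <-> forall u, 0 < aphi X Y u /\ 0 < curve_q X Y u).
Proof.
  intros HX HY.
  assert (K : (forall v, 0 < aphi X Y v) -> forall u,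
            curve_q X Y u = akappa X Y u * ads X Y u ^ 2).
  { intros Hp u. rewrite akappa_jet by assumption.
    assert (H := ads_pos X Y u). field. lra. }
  split; intros H u; split; try apply H.
  - rewrite K by apply H. apply Rmult_lt_0_compat; [apply H|].
    apply pow_lt, ads_pos.
  - rewrite akappa_jet by (try apply H; assumption).
    apply Rdiv_lt_0_compat; [apply H|apply pow_lt, ads_pos].
Qed.

Lemma F_sqrtk_curve_q (L : R) (X Y : R -> R) :
  smooth1 X -> smooth1 Y -> pos_curved X Y ->
  F_sqrtk L X Y = RInt (fun u => sqrt (curve_q X Y u)) 0 L.
Proof.
  intros HX HY Hp. unfold F_sqrtk.
  apply (f_equal (fun f => RInt f 0 L)). extensionality u.
  rewrite akappa_jet by (try apply Hp; assumption).
  assert (H := ads_pos X Y u).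
  rewrite sqrt_div_alt by now apply pow_lt.
  rewrite sqrt_pow2 by lra. field. lra.
Qed.

(** The time derivative of [curve_q] by the quotient rule, one factor [phi] cancelled. It is kept as
    an explicit rational expression so that the joint continuity required for differentiating under
    the integral can be read off. *)
Definition d_curve_q (GX GY : R -> R -> R) (t u : R) : R :=
  let D v w := pdet GX GY (jet v) (jet w) t u in
  let dD v w := pdet GX GY (true :: jet v) (jet w) t u
                + pdet GX GY (jet v) (true :: jet w) t u in
  let phi := D 1%nat 2%nat in
  let a := 4 * D 2%nat 3%nat + D 1%nat 4%nat in
  let da := 4 * dD 2%nat 3%nat + dD 1%nat 4%nat in
  let c := D 1%nat 3%nat in
  ((3 * phi * da - 3 * dD 1%nat 2%nat * a - 10 * c * dD 1%nat 3%nat) * phi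
    + 10 * c * c * dD 1%nat 2%nat) / (9 * phi * phi * phi).

Lemma is_derive_curve_q (GX GY : R -> R -> R) (t u : R) :
  smooth2 GX -> smooth2 GY -> 0 < aphi (GX t) (GY t) u ->
  is_derive (fun t' => curve_q (GX t') (GY t') u) t (d_curve_q GX GY t u).
Proof.
  intros HX HY Hphi. rewrite aphi_slice in Hphi.
  assert (quotient : forall P A C : R -> R, forall dP dA dC : R,
    0 < P t -> is_derive P t dP -> is_derive A t dA -> is_derive C t dC ->
    is_derive (fun s => (3 * P s * A s - 5 * C s * C s) / (9 * P s * P s)) t
      (((3 * P t * dA - 3 * dP * A t - 10 * C t * dC) * P t + 10 * C t * C t * dP)
       / (9 * P t * P t * P t))).
  { intros P A C dP dA dC HP DP DA DC. auto_derive.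
    - repeat split; try (eexists; eassumption). nra.
    - rewrite_Derives. field. lra. }
  assert (D : forall v w, is_derive (fun t' => pdet GX GY v w t' u) t
    (pdet GX GY (true :: v) w t u + pdet GX GY v (true :: w) t u))
    by (intros; now apply is_derive_pdet).
  refine (is_derive_ext _ _ _ _ (fun t' => eq_sym (curve_q_slice GX GY t' u))
    (quotient (fun t' => pdet GX GY (jet 1) (jet 2) t' u)
       (fun t' => 4 * pdet GX GY (jet 2) (jet 3) t' u + pdet GX GY (jet 1) (jet 4) t' u)
       (fun t' => pdet GX GY (jet 1) (jet 3) t' u) _ _ _ Hphi (D _ _) _ (D _ _))).
  apply is_derive_Rplus; [apply is_derive_scal|]; apply D.
Qed.

Lemma continuity_2d_curve_q (GX GY : R -> R -> R) (t u : R) :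
  smooth2 GX -> smooth2 GY -> 0 < aphi (GX t) (GY t) u ->
  continuity_2d_pt (fun t u => curve_q (GX t) (GY t) u) t u.
Proof.
  intros HX HY Hphi. rewrite aphi_slice in Hphi.
  refine (continuity_2d_pt_ext _ _ _ _ (fun t' u' => eq_sym (curve_q_slice GX GY t' u')) _).
  cbv zeta. unfold Rdiv.
  repeat first [now apply continuity_2d_pdet | apply continuity_2d_pt_const
               | apply continuity_2d_pt_minus | apply continuity_2d_pt_plus
               | apply continuity_2d_pt_mult | apply continuity_2d_pt_inv].
  apply Rgt_not_eq. repeat apply Rmult_lt_0_compat; lra.
Qed.

Lemma continuity_2d_d_curve_q (GX GY : R -> R -> R) (t u : R) :
  smooth2 GX -> smooth2 GY -> 0 < aphi (GX t) (GY t) u ->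
  continuity_2d_pt (d_curve_q GX GY) t u.
Proof.
  intros HX HY Hphi. rewrite aphi_slice in Hphi.
  unfold d_curve_q, Rdiv. cbv zeta.
  repeat first [now apply continuity_2d_pdet | apply continuity_2d_pt_const
               | apply continuity_2d_pt_minus | apply continuity_2d_pt_plus
               | apply continuity_2d_pt_mult | apply continuity_2d_pt_inv].
  apply Rgt_not_eq. repeat apply Rmult_lt_0_compat; lra.
Qed.

Lemma continuity_2d_continuous (f : R -> R -> R) (t u : R) :
  continuity_2d_pt f t u -> continuous (f t) u.
Proof.
  intros H. apply continuity_pt_filterlim.
  intros eps Heps. destruct (H (mkposreal eps Heps)) as [d Hd].
  exists d. split; [apply cond_pos|]. intros v [_ Hv].
  apply Hd; [|exact Hv]. rewrite Rminus_diag, Rabs_R0. apply cond_pos.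
Qed.

(** Differentiation under the integral sign. Positivity is available only for [|t| < eps], so both
    the passage to [curve_q] and the derivative of the root are local in [t]. *)
Lemma is_derive_F_sqrtk (L : R) (X Y : R -> R) (GX GY : R -> R -> R) :
  variation L X Y GX GY ->
  is_derive (fun t => F_sqrtk L (GX t) (GY t)) 0
    (RInt (fun u => d_curve_q GX GY 0 u / (2 * sqrt (curve_q X Y u))) 0 L).
Proof.
  intros (HX & HY & H0 & _ & eps & Heps & Hpos).
  assert (EX : GX 0 = X) by (extensionality u; apply H0).
  assert (EY : GY 0 = Y) by (extensionality u; apply H0).
  assert (Near : forall P : R -> Prop, (forall t, Rabs t < eps -> P t) -> locally 0 P).
  { intros P HP. exists (mkposreal eps Heps). intros t Ht. apply HP.
    change (Rabs (t - 0) < eps) in Ht. now rewrite Rminus_0_r in Ht. }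
  assert (Hq : forall t, Rabs t < eps ->
            forall u, 0 < aphi (GX t) (GY t) u /\ 0 < curve_q (GX t) (GY t) u).
  { intros t Ht. apply pos_curved_curve_q; auto using smooth2_slice. }
  apply (is_derive_ext_loc (fun t => RInt (fun u => sqrt (curve_q (GX t) (GY t) u)) 0 L)).
  { apply Near. intros t Ht. symmetry.
    apply F_sqrtk_curve_q; auto using smooth2_slice. }
  assert (D : forall t, Rabs t < eps -> forall u,
    is_derive (fun t' => sqrt (curve_q (GX t') (GY t') u)) t
      (d_curve_q GX GY t u / (2 * sqrt (curve_q (GX t) (GY t) u)))).
  { intros t Ht u. apply (is_derive_sqrt (fun t' => curve_q (GX t') (GY t') u)).
    - apply is_derive_curve_q; auto. now apply Hq.
    - now apply Hq. }
  assert (E0 : Rabs 0 < eps) by (rewrite Rabs_R0; exact Heps).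
  eapply is_derive_eq.
  - apply is_derive_RInt_param.
    + apply Near. intros t Ht u _. eexists. now apply D.
    + intros u _.
      apply (continuity_2d_pt_ext_loc
        (fun t u => d_curve_q GX GY t u / (2 * sqrt (curve_q (GX t) (GY t) u)))).
      { exists (mkposreal eps Heps). intros t v Ht _. simpl in Ht.
        rewrite Rminus_0_r in Ht. symmetry. apply is_derive_unique. now apply D. }
      assert (Hu := Hq 0 E0 u).
      apply continuity_2d_pt_mult; [now apply continuity_2d_d_curve_q|].
      apply continuity_2d_pt_inv.
      * apply continuity_2d_pt_mult; [apply continuity_2d_pt_const|].
        apply (continuity_1d_2d_pt_comp sqrt).
        -- apply continuity_pt_sqrt. lra.
        -- now apply continuity_2d_curve_q.
      * assert (0 < sqrt (curve_q (GX 0) (GY 0) u)) by now apply sqrt_lt_R0. lra.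
    + apply Near. intros t Ht. apply (ex_RInt_continuous (V := R_CompleteNormedModule)).
      intros u _. apply continuous_comp.
      * apply (continuity_2d_continuous (fun t u => curve_q (GX t) (GY t) u)).
        apply continuity_2d_curve_q; auto. now apply Hq.
      * apply continuous_sqrt.
  - apply RInt_ext. intros u _.
    rewrite <- EX, <- EY. exact (is_derive_unique _ _ _ (D 0 E0 u)).
Qed.

(** * Equi-affine arc-length parametrisations *)

Lemma periodic_all (L : R) (P : R -> Prop) :
  0 < L -> (forall u, P (u + L) <-> P u) -> (forall u, 0 <= u < L -> P u) ->
  forall u, P u.
Proof.
  intros HL Hper H u.
  assert (Hnat : forall n v, P (v + INR n * L) <-> P v).
  { induction n as [|n IH]; intros v.
    - replace (v + INR 0 * L) with v by (simpl; ring). reflexivity.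
    - rewrite S_INR. replace (v + (INR n + 1) * L) with ((v + INR n * L) + L) by ring.
      now rewrite Hper. }
  destruct (base_Int_part (u / L)) as [B1 B2].
  set (z := Int_part (u / L)) in *.
  assert (Hz : IZR z * L <= u < (IZR z + 1) * L).
  { assert (E : u = u / L * L) by (field; lra). split; [rewrite E at 1; nra|rewrite E at 1; nra]. }
  destruct (Z_le_gt_dec 0 z) as [Hs|Hs].
  - destruct (Z_of_nat_complete z Hs) as [n Hn].
    rewrite Hn, <- INR_IZR_INZ in Hz.
    replace u with ((u - INR n * L) + INR n * L) by ring.
    apply Hnat, H. lra.
  - destruct (Z_of_nat_complete (- z)) as [n Hn]; [lia|].
    assert (E : IZR z = - INR n).
    { rewrite INR_IZR_INZ, <- Hn, opp_IZR. ring. }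
    rewrite E in Hz. apply (Hnat n), H. lra.
Qed.

(** Compactness of [[0, L]] makes the bound on [t] uniform in [u]: uniform continuity is applied
    with the minimum of [f 0] as tolerance. *)
Lemma positive_nearby (f : R -> R -> R) (L : R) :
  0 < L -> (forall u, continuity_2d_pt f 0 u) -> (forall u, 0 < f 0 u) ->
  exists eps, 0 < eps /\
    forall t, Rabs t < eps -> forall u, 0 <= u <= L -> 0 < f t u.
Proof.
  intros HL Hc Hpos.
  destruct (continuity_ab_min (f 0) 0 L) as (m & Hm & _); [lra| |].
  { intros u _. apply continuity_pt_filterlim, (continuity_2d_continuous f 0 u), Hc. }
  destruct (uniform_continuity_2d_1d' f 0 L 0 (fun u _ => Hc u)
              (mkposreal _ (Hpos m))) as [d Hd].
  exists d. split; [apply cond_pos|]. intros t Ht u Hu.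
  apply Rabs_def2 in Ht.
  assert (Hdp := cond_pos d).
  specialize (Hd u 0 u t Hu ltac:(lra) Hu ltac:(lra)).
  rewrite Rminus_diag, Rabs_R0 in Hd. specialize (Hd Hdp). simpl in Hd.
  apply Rabs_def2 in Hd. specialize (Hm u Hu). lra.
Qed.

Lemma Derive_n_periodic (f : R -> R) (L : R) (n : nat) :
  smooth1 f -> (forall u, f (u + L) = f u) ->
  forall u, Derive_n f n (u + L) = Derive_n f n u.
Proof.
  intros Hf HL.
  (* A family constant in [t] reduces the claim to [pd_periodic]. *)
  assert (HG : smooth2 (fun t u => f u + t * 0)).
  { apply (smooth2_affine f (fun _ => 0)); [exact Hf|apply smooth1_const]. }
  intros u. rewrite <- (Rplus_0_r (Derive_n f n u)), <- (Rplus_0_r (Derive_n f n (u + L))).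
  assert (E : (fun u : R => f u + 0 * 0) = f) by (extensionality v; ring).
  rewrite <- E.
  change (fun u : R => f u + 0 * 0) with ((fun t u => f u + t * 0) 0).
  rewrite !Derive_n_slice. f_equal. apply (pd_periodic _ L); [exact HG|].
  intros t v. now rewrite HL.
Qed.

(** Positivity for small [t] is obtained for [aphi] and [curve_q] on one period by compactness and
    extended by periodicity. *)
Lemma variation_affine (L : R) (X Y A B : R -> R) :
  0 < L -> smooth1 X -> smooth1 Y -> smooth1 A -> smooth1 B ->
  (forall u, X (u + L) = X u /\ Y (u + L) = Y u) ->
  (forall u, A (u + L) = A u /\ B (u + L) = B u) ->
  pos_curved X Y ->
  variation L X Y (fun t u => X u + t * A u) (fun t u => Y u + t * B u).
Proof.
  intros HL HX HY HA HB PXY PAB Hpos.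
  set (GX := fun t u => X u + t * A u). set (GY := fun t u => Y u + t * B u).
  assert (SX : smooth2 GX) by now apply smooth2_affine.
  assert (SY : smooth2 GY) by now apply smooth2_affine.
  assert (EX : GX 0 = X) by (extensionality u; unfold GX; ring).
  assert (EY : GY 0 = Y) by (extensionality u; unfold GY; ring).
  assert (Per : forall t u, GX t (u + L) = GX t u /\ GY t (u + L) = GY t u).
  { intros t u. unfold GX, GY. destruct (PXY u) as [-> ->], (PAB u) as [-> ->]. easy. }
  refine (conj SX (conj SY (conj _ (conj Per _)))).
  - intros u. now rewrite EX, EY.
  - rewrite pos_curved_curve_q in Hpos by assumption.
    destruct (positive_nearby (fun t => aphi (GX t) (GY t)) L) as (e1 & He1 & H1).
    { exact HL. }
    { intros u. apply (continuity_2d_pt_ext (pdet GX GY (jet 1) (jet 2))).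
      - intros t v. symmetry. apply aphi_slice.
      - now apply continuity_2d_pdet. }
    { intros u. rewrite EX, EY. apply Hpos. }
    destruct (positive_nearby (fun t => curve_q (GX t) (GY t)) L) as (e2 & He2 & H2).
    { exact HL. }
    { intros u. apply continuity_2d_curve_q; auto. rewrite EX, EY. apply Hpos. }
    { intros u. rewrite EX, EY. apply Hpos. }
    exists (Rmin e1 e2). split; [now apply Rmin_glb_lt|]. intros t Ht.
    assert (Rabs t < e1) by (eapply Rlt_le_trans; [exact Ht|apply Rmin_l]).
    assert (Rabs t < e2) by (eapply Rlt_le_trans; [exact Ht|apply Rmin_r]).
    apply pos_curved_curve_q; [now apply smooth2_slice..|].
    apply (periodic_all L); [exact HL| |].
    + intros u. unfold curve_q. rewrite !aphi_slice, !Derive_n_slice. unfold pdet.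
      rewrite !(pd_periodic GX L) by (auto; apply Per).
      now rewrite !(pd_periodic GY L) by (auto; apply Per).
    + intros u Hu. split; [apply H1|apply H2]; auto; lra.
Qed.

Definition det2 (a b c d : R) : R := a * d - b * c.

Lemma is_derive_det2 (a b c d : R -> R) (u a' b' c' d' : R) :
  is_derive a u a' -> is_derive b u b' -> is_derive c u c' -> is_derive d u d' ->
  is_derive (fun v => det2 (a v) (b v) (c v) (d v)) u
    (det2 a' b' (c u) (d u) + det2 (a u) (b u) c' d').
Proof.
  intros Ha Hb Hc Hd. unfold det2. eapply is_derive_eq.
  - exact (is_derive_Rminus _ _ _ _ _ (is_derive_Rmult _ _ _ _ _ Ha Hd)
             (is_derive_Rmult _ _ _ _ _ Hb Hc)).
  - ring.
Qed.

Definition arc_curve (X Y k : R -> R) : Prop :=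
  smooth1 X /\ smooth1 Y /\ smooth1 k /\ (forall u, 0 < k u) /\
  equiaffine_arclength X Y /\
  forall u, Derive_n X 3 u = - k u * Derive_n X 1 u /\
            Derive_n Y 3 u = - k u * Derive_n Y 1 u.

(** [strictly_pos_curved_al] provides [kappa] without any regularity; its smoothness comes from
    [kappa = |c'', c'''|], obtained by pairing [c''' = - kappa c'] with [c'']. *)
Lemma arc_curve_intro (X Y : R -> R) :
  smooth1 X -> smooth1 Y -> equiaffine_arclength X Y -> strictly_pos_curved_al X Y ->
  exists k, arc_curve X Y k.
Proof.
  intros HX HY Ha (k & Hk & H3). exists k.
  refine (conj HX (conj HY (conj _ (conj Hk (conj Ha H3))))).
  assert (E : k = fun u => Derive_n X 2 u * Derive_n Y 3 u
                           + (- 1) * (Derive_n Y 2 u * Derive_n X 3 u)).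
  { extensionality u. destruct (H3 u) as [-> ->].
    specialize (Ha u). transitivity (k u * 1); [ring|]. rewrite <- Ha. ring. }
  assert (S : forall f n, smooth1 f -> smooth1 (Derive_n f n)).
  { intros f n Hf. induction n as [|n IH]; [exact Hf|now apply smooth1_Derive]. }
  rewrite E.
  exact (smooth1_plus _ _ (smooth1_mult _ _ (S X 2%nat HX) (S Y 3%nat HY))
    (smooth1_mult _ _ (smooth1_const (- 1))
       (smooth1_mult _ _ (S Y 2%nat HY) (S X 3%nat HX)))).
Qed.

Lemma arc_curve_jet4 (X Y k : R -> R) (u : R) :
  arc_curve X Y k ->
  Derive_n X 4 u = - Derive k u * Derive_n X 1 u - k u * Derive_n X 2 u /\
  Derive_n Y 4 u = - Derive k u * Derive_n Y 1 u - k u * Derive_n Y 2 u.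
Proof.
  intros (HX & HY & Hk & _ & _ & H3).
  assert (K : forall Z, smooth1 Z ->
    (forall u, Derive_n Z 3 u = - k u * Derive_n Z 1 u) ->
    Derive_n Z 4 u = - Derive k u * Derive_n Z 1 u - k u * Derive_n Z 2 u).
  { intros Z HZ E. change (Derive_n Z 4 u) with (Derive (Derive_n Z 3) u).
    rewrite (Derive_ext _ _ _ E). apply is_derive_unique. eapply is_derive_eq.
    - apply is_derive_Rmult.
      + apply (is_derive_opp k u (Derive k u)), (smooth1_Derive_n k 0 u), Hk.
      + now apply smooth1_Derive_n.
    - unfold opp; simpl. ring. }
  split; apply K; auto; apply H3.
Qed.

(** At arc length [phi = 1], [|c', c'''| = 0], [|c'', c'''| = kappa] and [|c', c''''| = - kappa], so
    the general curvature formula returns the [kappa] of [c''' = - kappa c']. *)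
Lemma arc_curve_curve_q (X Y k : R -> R) (u : R) :
  arc_curve X Y k -> aphi X Y u = 1 /\ curve_q X Y u = k u.
Proof.
  intros H. assert (H4 := arc_curve_jet4 X Y k u H).
  destruct H as (_ & _ & _ & _ & Ha & H3). specialize (Ha u).
  split; [exact Ha|].
  change (Derive X u) with (Derive_n X 1 u) in Ha.
  change (Derive Y u) with (Derive_n Y 1 u) in Ha.
  unfold curve_q, jet_q. destruct H4 as [-> ->], (H3 u) as [-> ->].
  replace (Derive_n X 1 u * Derive_n Y 2 u - Derive_n Y 1 u * Derive_n X 2 u) with 1.
  match goal with |- ?n / ?d = _ =>
    replace n with (9 * k u * (Derive_n X 1 u * Derive_n Y 2 u - Derive_n Y 1 u * Derive_n X 2 u))
     by ring end.
  rewrite Ha. field.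
Qed.

Lemma arc_curve_pos_curved (X Y k : R -> R) : arc_curve X Y k -> pos_curved X Y.
Proof.
  intros H. apply pos_curved_curve_q; try apply H.
  intros u. destruct (arc_curve_curve_q X Y k u H) as [-> ->].
  split; [lra|apply H].
Qed.

(* [U j], [V j] are the components of the [j]-th derivative of the variation field. *)
Definition var_density (X Y k : R -> R) (U V : nat -> R -> R) (u : R) : R :=
  let T j := det2 (Derive_n X 1 u) (Derive_n Y 1 u) (U j u) (V j u) in
  let N j := det2 (Derive_n X 2 u) (Derive_n Y 2 u) (U j u) (V j u) in
  T 4%nat + 4 * N 3%nat + k u * T 2%nat + 4 * k u * N 1%nat + Derive k u * T 1%nat.

(** Found from [T_j' = N_j + T_(j+1)] and [N_j' = N_(j+1) - kappa T_j]. Its derivative is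
    [var_density] up to a term with the factor [kappa'], so for constant curvature the density is
    exact for every field. *)
Definition var_primitive (X Y k : R -> R) (U V : nat -> R -> R) (u : R) : R :=
  let T j := det2 (Derive_n X 1 u) (Derive_n Y 1 u) (U j u) (V j u) in
  let N j := det2 (Derive_n X 2 u) (Derive_n Y 2 u) (U j u) (V j u) in
  T 3%nat + 3 * N 2%nat + 4 * k u * T 1%nat.

(** Let [a = 4 |c'', c'''| + |c', c''''|]. At arc length [phi = 1], [|c', c'''| = 0] and
    [a = 3 kappa], so [q] linearises to a third of [delta a - 3 kappa delta phi]; substituting
    [c''' = - kappa c'] gives [var_density]. *)
Lemma d_curve_q_arc (X Y k : R -> R) (GX GY : R -> R -> R) (u : R) :
  arc_curve X Y k -> GX 0 = X -> GY 0 = Y ->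
  d_curve_q GX GY 0 u =
    var_density X Y k (fun j => pd (true :: jet j) GX 0)
                      (fun j => pd (true :: jet j) GY 0) u / 3.
Proof.
  intros H EX EY. assert (H4 := arc_curve_jet4 X Y k u H).
  destruct H as (_ & _ & _ & _ & Ha & H3). specialize (Ha u).
  change (Derive X u) with (Derive_n X 1 u) in Ha.
  change (Derive Y u) with (Derive_n Y 1 u) in Ha.
  specialize (H3 u).
  unfold d_curve_q, var_density, pdet, det2. cbv zeta.
  rewrite <- !Derive_n_slice, EX, EY.
  destruct H4 as [-> ->], H3 as [-> ->].
  generalize dependent (Derive_n X 1 u). intros x1.
  generalize dependent (Derive_n X 2 u). intros x2.
  generalize dependent (Derive_n Y 1 u). intros y1.
  generalize dependent (Derive_n Y 2 u). intros y2.
  intros Ha.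
  generalize (pd (true :: jet 1) GX 0 u) (pd (true :: jet 2) GX 0 u)
    (pd (true :: jet 3) GX 0 u) (pd (true :: jet 4) GX 0 u)
    (pd (true :: jet 1) GY 0 u) (pd (true :: jet 2) GY 0 u)
    (pd (true :: jet 3) GY 0 u) (pd (true :: jet 4) GY 0 u).
  intros a1 a2 a3 a4 b1 b2 b3 b4. rewrite !Ha.
  replace (x1 * (- k u * y1) - y1 * (- k u * x1)) with 0 by ring.
  replace (x2 * (- k u * y1) - y2 * (- k u * x1)) with (k u * (x1 * y2 - y1 * x2)) by ring.
  replace (x1 * (- Derive k u * y1 - k u * y2) - y1 * (- Derive k u * x1 - k u * x2))
    with (- k u * (x1 * y2 - y1 * x2)) by ring.
  rewrite Ha. field.
Qed.

Lemma is_derive_var_primitive (X Y k : R -> R) (U V : nat -> R -> R) (u : R) :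
  arc_curve X Y k ->
  (forall j v, is_derive (U j) v (U (S j) v)) ->
  (forall j v, is_derive (V j) v (V (S j) v)) ->
  is_derive (var_primitive X Y k U V) u
    (var_density X Y k U V u
     + 3 * Derive k u * det2 (Derive_n X 1 u) (Derive_n Y 1 u) (U 1%nat u) (V 1%nat u)).
Proof.
  intros (HX & HY & Hk & _ & _ & H3) HU HV. specialize (H3 u).
  assert (DX1 := smooth1_Derive_n X 1 u HX). assert (DX2 := smooth1_Derive_n X 2 u HX).
  assert (DY1 := smooth1_Derive_n Y 1 u HY). assert (DY2 := smooth1_Derive_n Y 2 u HY).
  assert (Dk := smooth1_Derive_n k 0 u Hk).
  change (is_derive k u (Derive k u)) in Dk.
  destruct H3 as [E1 E2]. rewrite E1 in DX2. rewrite E2 in DY2. clear E1 E2.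
  assert (DT := fun j => is_derive_det2 _ _ _ _ u _ _ _ _ DX1 DY1 (HU j u) (HV j u)).
  assert (DN := fun j => is_derive_det2 _ _ _ _ u _ _ _ _ DX2 DY2 (HU j u) (HV j u)).
  eapply is_derive_eq.
  - refine (is_derive_Rplus _ _ _ _ _
      (is_derive_Rplus _ _ _ _ _ (DT 3%nat) (is_derive_scal _ _ 3 _ (DN 2%nat)))
      (is_derive_Rmult _ _ _ _ _ (is_derive_scal _ _ 4 _ Dk) (DT 1%nat))).
  - unfold var_density, det2. cbv zeta. ring.
Qed.

(** * Critical curves have constant curvature *)

Lemma is_derive_continuous (f : R -> R) (x l : R) : is_derive f x l -> continuous f x.
Proof. intros H. apply (ex_derive_continuous (V := R_NormedModule)). now exists l. Qed.

Lemma continuous_Rmult (f g : R -> R) (x : R) :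
  continuous f x -> continuous g x -> continuous (fun u => f u * g u) x.
Proof. exact (continuous_mult f g x). Qed.

Lemma is_derive_zero_const (f : R -> R) :
  (forall x, is_derive f x 0) -> forall x y, f x = f y.
Proof.
  intros Hf x y.
  destruct (MVT_gen f y x (fun _ => 0)) as (c & _ & Hc).
  - intros; apply Hf.
  - intros z _. apply continuity_pt_filterlim, (is_derive_continuous f z 0), Hf.
  - lra.
Qed.

Lemma ex_RInt_continuous_R (f : R -> R) (a b : R) :
  (forall u, continuous f u) -> ex_RInt f a b.
Proof. intros H. apply (ex_RInt_continuous (V := R_CompleteNormedModule)). auto. Qed.

(** A positive value persists on a short interval to the right of [u]; the endpoint [L] is left out
    so that this interval fits into [[0, L]]. *)
Lemma RInt_nonneg_eq_0 (f : R -> R) (L : R) :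
  (forall u, continuous f u) -> (forall u, 0 <= u <= L -> 0 <= f u) -> RInt f 0 L = 0 ->
  forall u, 0 <= u < L -> f u = 0.
Proof.
  intros Hc Hpos H0 u Hu.
  destruct (Rle_lt_or_eq_dec 0 (f u)) as [Hlt|]; [apply Hpos; lra| |congruence].
  exfalso.
  assert (C := proj2 (continuity_pt_filterlim f u) (Hc u)).
  destruct (C (f u) Hlt) as (d & Hd & Hd').
  set (v := u + Rmin (d / 2) ((L - u) / 2)).
  assert (M1 := Rmin_l (d / 2) ((L - u) / 2)).
  assert (M2 := Rmin_r (d / 2) ((L - u) / 2)).
  assert (M3 : 0 < Rmin (d / 2) ((L - u) / 2)) by (apply Rmin_glb_lt; lra).
  assert (Hv : u < v <= u + d / 2 /\ v < L) by (unfold v; lra).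
  assert (P : 0 < RInt f u v).
  { apply RInt_gt_0; [lra| |intros; apply Hc].
    intros x Hx. assert (K : Rabs (f x - f u) < f u).
    { apply Hd'. split; [split; [exact I|lra]|].
      simpl. unfold R_dist. rewrite Rabs_pos_eq; lra. }
    apply Rabs_def2 in K. lra. }
  assert (E : forall a b, ex_RInt f a b) by (intros; now apply ex_RInt_continuous_R).
  assert (Q1 : 0 <= RInt f 0 u) by (apply RInt_ge_0; auto; [lra|]; intros; apply Hpos; lra).
  assert (Q2 : 0 <= RInt f v L) by (apply RInt_ge_0; auto; [lra|]; intros; apply Hpos; lra).
  assert (S1 := RInt_Chasles f 0 u v (E _ _) (E _ _)).
  assert (S2 := RInt_Chasles f 0 v L (E _ _) (E _ _)).
  unfold plus in *; simpl in *. lra.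
Qed.

Lemma RInt_derive_periodic (f df : R -> R) (L : R) :
  (forall u, is_derive f u (df u)) -> (forall u, continuous df u) ->
  f L = f 0 -> RInt df 0 L = 0.
Proof.
  intros Hf Hdf E.
  assert (H : is_RInt df 0 L (minus (f L) (f 0))) by (apply (is_RInt_derive f df); auto).
  rewrite (is_RInt_unique _ _ _ _ H), E. exact (Rminus_diag (f 0)).
Qed.

(** The constant 6 is the 3 of [d_curve_q_arc] times the 2 from differentiating the root. *)
Lemma first_variation (L : R) (X Y k : R -> R) (GX GY : R -> R -> R) :
  arc_curve X Y k -> variation L X Y GX GY ->
  first_var (F_sqrtk L) GX GY =
    RInt (fun u => var_density X Y k (fun j => pd (true :: jet j) GX 0)
                     (fun j => pd (true :: jet j) GY 0) u / (6 * sqrt (k u))) 0 L.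
Proof.
  intros H HG. apply is_derive_unique. eapply is_derive_eq; [apply (is_derive_F_sqrtk L X Y GX GY HG)|].
  apply (f_equal (fun f => RInt f 0 L)). extensionality u.
  destruct HG as (_ & _ & H0 & _).
  rewrite (d_curve_q_arc X Y k) by (try assumption; extensionality v; apply H0).
  destruct (arc_curve_curve_q X Y k u H) as [_ ->].
  assert (0 < sqrt (k u)) by apply sqrt_lt_R0, H. field. lra.
Qed.

Lemma pd_t_jet_is_derive (G : R -> R -> R) (j : nat) (u : R) :
  smooth2 G ->
  is_derive (pd (true :: jet j) G 0) u (pd (true :: jet (S j)) G 0 u).
Proof.
  intros HG. change (jet (S j)) with (false :: jet j). rewrite (pd_swap G (jet j)) by exact HG.
  apply (smooth2_is_derive_u G (true :: jet j) 0 u HG).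
Qed.

Lemma continuous_var_density (X Y k : R -> R) (U V : nat -> R -> R) (u : R) :
  arc_curve X Y k ->
  (forall j v, is_derive (U j) v (U (S j) v)) ->
  (forall j v, is_derive (V j) v (V (S j) v)) ->
  continuous (var_density X Y k U V) u.
Proof.
  intros (HX & HY & Hk & _ & _ & _) HU HV.
  assert (DT := fun i j => is_derive_det2 _ _ _ _ u _ _ _ _
    (smooth1_Derive_n X i u HX) (smooth1_Derive_n Y i u HY) (HU j u) (HV j u)).
  assert (Dk := smooth1_Derive_n k 0 u Hk). assert (Dk1 := smooth1_Derive_n k 1 u Hk).
  change (is_derive k u (Derive_n k 1 u)) in Dk.
  change (is_derive (Derive k) u (Derive_n k 2 u)) in Dk1.
  eapply is_derive_continuous.
  exact (is_derive_Rplus _ _ _ _ _ (is_derive_Rplus _ _ _ _ _ (is_derive_Rplus _ _ _ _ _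
    (is_derive_Rplus _ _ _ _ _ (DT 1%nat 4%nat) (is_derive_scal _ _ 4 _ (DT 2%nat 3%nat)))
    (is_derive_Rmult _ _ _ _ _ Dk (DT 1%nat 2%nat)))
    (is_derive_Rmult _ _ _ _ _ (is_derive_scal _ _ 4 _ Dk) (DT 2%nat 1%nat)))
    (is_derive_Rmult _ _ _ _ _ Dk1 (DT 1%nat 1%nat))).
Qed.

Lemma first_var_const_curvature (L k0 : R) (X Y : R -> R) (GX GY : R -> R -> R) :
  arc_curve X Y (fun _ => k0) -> (forall u, X (u + L) = X u /\ Y (u + L) = Y u) ->
  variation L X Y GX GY -> first_var (F_sqrtk L) GX GY = 0.
Proof.
  intros H PXY HG. rewrite (first_variation L X Y _ GX GY H HG).
  destruct HG as (SX & SY & _ & PG & _).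
  set (U := fun j => pd (true :: jet j) GX 0). set (V := fun j => pd (true :: jet j) GY 0).
  assert (HU : forall j v, is_derive (U j) v (U (S j) v))
    by (intros; now apply pd_t_jet_is_derive).
  assert (HV : forall j v, is_derive (V j) v (V (S j) v))
    by (intros; now apply pd_t_jet_is_derive).
  assert (Hk0 : 0 < k0) by (destruct H as (_ & _ & _ & Hk & _); apply (Hk 0)).
  assert (Hs := sqrt_lt_R0 _ Hk0).
  apply (RInt_derive_periodic
    (fun u => / (6 * sqrt k0) * var_primitive X Y (fun _ => k0) U V u)).
  - intros u. eapply is_derive_eq.
    + apply is_derive_scal, (is_derive_var_primitive X Y _ U V u H HU HV).
    + rewrite Derive_const. field. lra.
  - intros u. apply continuous_Rmult; [|apply continuous_const].
    now apply continuous_var_density.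
  - f_equal. unfold var_primitive. rewrite <- (Rplus_0_l L).
    rewrite !(Derive_n_periodic X L), !(Derive_n_periodic Y L) by (try apply H; apply PXY).
    unfold U, V.
    rewrite !(pd_periodic GX L) by (auto; apply PG).
    now rewrite !(pd_periodic GY L) by (auto; apply PG).
Qed.

(* The variation field is [N / kappa], i.e. [p^2 N] with [p = kappa^(-1/2)]: the first variation of
   the integral of [sqrt kappa] in direction [f N] is one sixth of the integral of [(p'''' + p'' / p^2) f],
   and [p^2 p'''' + p''] equals [2 p p''^2] up to an exact derivative. *)
Lemma critical_curvature_const (L : R) (X Y k : R -> R) :
  0 < L -> arc_curve X Y k -> (forall u, X (u + L) = X u /\ Y (u + L) = Y u) ->
  critical L (F_sqrtk L) X Y -> exists k0, k = fun _ => k0.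
Proof.
  intros HL H PXY Hcrit.
  assert (H' := H). destruct H' as (HX & HY & Hk & Hk0 & Ha & H3).
  set (p := fun u => / sqrt (k u)).
  assert (Hp : smooth1 p) by now apply smooth1_inv_sqrt.
  assert (Hp0 : forall u, 0 < p u) by (intros u; apply Rinv_0_lt_compat, sqrt_lt_R0, Hk0).
  assert (Ek : forall u, k u = / (p u * p u)).
  { intros u. unfold p. rewrite <- Rinv_mult, Rinv_inv. symmetry. apply sqrt_sqrt.
    now apply Rlt_le. }
  set (p1 := Derive_n p 1). set (p2 := Derive_n p 2). set (p3 := Derive_n p 3).
  assert (Dp : forall u, is_derive p u (p1 u)) by (intros u; apply (smooth1_Derive_n p 0 u Hp)).
  assert (Dp1 : forall u, is_derive p1 u (p2 u)) by (intros u; apply (smooth1_Derive_n p 1 u Hp)).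
  assert (Dp2 : forall u, is_derive p2 u (p3 u)) by (intros u; apply (smooth1_Derive_n p 2 u Hp)).
  assert (Dk : forall u, Derive k u = - 2 * p1 u / p u ^ 3).
  { intros u. rewrite (Derive_ext _ _ _ Ek). apply is_derive_unique.
    specialize (Hp0 u). auto_derive.
    - repeat split; try (eexists; apply Dp). nra.
    - rewrite_Derives. field. lra. }
  set (A := fun (Z : R -> R) u => (p u * p u) * Derive_n Z 2 u).
  assert (HA : forall Z, smooth1 Z -> smooth1 (A Z)).
  { intros Z HZ. apply smooth1_mult; [now apply smooth1_mult|].
    apply (smooth1_Derive (Derive_n Z 1)), (smooth1_Derive Z), HZ. }
  (* The derivatives of [p^2 c''] are kept in the form [alpha c'' - beta c']: since [|c', c''| = 1],
     pairing with [c'] reads off [alpha] and pairing with [c''] reads off [beta]. *)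
  assert (jets : forall Z, smooth1 Z ->
    (forall u, Derive_n Z 3 u = - k u * Derive_n Z 1 u) ->
    (forall u, Derive_n (A Z) 1 u = 2 * p u * p1 u * Derive_n Z 2 u - Derive_n Z 1 u) /\
    (forall u, Derive_n (A Z) 2 u =
        (2 * p1 u * p1 u + 2 * p u * p2 u - 1) * Derive_n Z 2 u
        - 2 * p1 u / p u * Derive_n Z 1 u) /\
    (forall u, Derive_n (A Z) 3 u =
        (6 * p1 u * p2 u + 2 * p u * p3 u - 2 * p1 u / p u) * Derive_n Z 2 u
        - ((2 * p1 u * p1 u + 2 * p u * p2 u - 1) / p u ^ 2
           + 2 * p2 u / p u - 2 * p1 u ^ 2 / p u ^ 2) * Derive_n Z 1 u)).
  { intros Z HZ EZ.
    assert (D1 := fun u => smooth1_Derive_n Z 1 u HZ).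
    assert (D2 := fun u => smooth1_Derive_n Z 2 u HZ).
    assert (E1 : forall u, Derive_n (A Z) 1 u = 2 * p u * p1 u * Derive_n Z 2 u - Derive_n Z 1 u).
    { intros u. apply is_derive_unique. eapply is_derive_eq.
      - exact (is_derive_Rmult _ _ _ _ _ (is_derive_Rmult _ _ _ _ _ (Dp u) (Dp u)) (D2 u)).
      - rewrite EZ, Ek. specialize (Hp0 u). field. lra. }
    assert (E2 : forall u, Derive_n (A Z) 2 u =
        (2 * p1 u * p1 u + 2 * p u * p2 u - 1) * Derive_n Z 2 u
        - 2 * p1 u / p u * Derive_n Z 1 u).
    { intros u. transitivity (Derive (Derive_n (A Z) 1) u); [reflexivity|].
      rewrite (Derive_ext _ _ _ E1). apply is_derive_unique. eapply is_derive_eq.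
      - exact (is_derive_Rminus _ _ _ _ _ (is_derive_Rmult _ _ _ _ _
          (is_derive_Rmult _ _ _ _ _ (is_derive_scal _ _ 2 _ (Dp u)) (Dp1 u)) (D2 u)) (D1 u)).
      - rewrite EZ, Ek. specialize (Hp0 u). field. lra. }
    repeat split; auto. intros u.
    transitivity (Derive (Derive_n (A Z) 2) u); [reflexivity|].
    rewrite (Derive_ext _ _ _ E2). apply is_derive_unique.
    assert (Hpu := Hp0 u). eapply is_derive_eq.
    - exact (is_derive_Rminus _ _ _ _ _
        (is_derive_Rmult _ _ _ _ _ (is_derive_Rminus _ _ _ _ _ (is_derive_Rplus _ _ _ _ _
             (is_derive_Rmult _ _ _ _ _ (is_derive_scal _ _ 2 _ (Dp1 u)) (Dp1 u))
             (is_derive_Rmult _ _ _ _ _ (is_derive_scal _ _ 2 _ (Dp u)) (Dp2 u)))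
             (is_derive_const 1 u)) (D2 u))
        (is_derive_Rmult _ _ _ _ _ (is_derive_div _ _ _ _ _
             (is_derive_scal _ _ 2 _ (Dp1 u)) (Dp u) (Rgt_not_eq _ _ Hpu)) (D1 u))).
    - rewrite EZ, Ek. unfold zero; simpl. field. lra. }
  set (GX := fun t u => X u + t * A X u). set (GY := fun t u => Y u + t * A Y u).
  assert (Perk : forall u, k (u + L) = k u).
  { intros u. destruct (arc_curve_curve_q X Y k u H) as [_ <-].
    destruct (arc_curve_curve_q X Y k (u + L) H) as [_ <-]. unfold curve_q.
    now rewrite !(Derive_n_periodic X L), !(Derive_n_periodic Y L) by (auto; apply PXY). }
  assert (Perp : forall u, p (u + L) = p u) by (intros u; unfold p; now rewrite Perk).
  assert (HG : variation L X Y GX GY).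
  { apply variation_affine; auto.
    - intros u. unfold A. rewrite Perp.
      now rewrite !(Derive_n_periodic X L), !(Derive_n_periodic Y L) by (auto; apply PXY).
    - now apply (arc_curve_pos_curved X Y k). }
  specialize (Hcrit GX GY HG). rewrite (first_variation L X Y k GX GY H HG) in Hcrit.
  set (U := Derive_n (A X)). set (V := Derive_n (A Y)).
  assert (HU : forall j v, is_derive (U j) v (U (S j) v))
    by (intros; now apply smooth1_Derive_n, HA).
  assert (HV : forall j v, is_derive (V j) v (V (S j) v))
    by (intros; now apply smooth1_Derive_n, HA).
  replace (fun j => pd (true :: jet j) GX 0) with U in Hcrit
    by (extensionality j; extensionality u; symmetry; now apply pd_t_affine, HA).
  replace (fun j => pd (true :: jet j) GY 0) with V in Hcrit
    by (extensionality j; extensionality u; symmetry; now apply pd_t_affine, HA).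
  assert (Cp : forall u, continuous p u) by (intros u; eapply is_derive_continuous, Dp).
  assert (Cp2 : forall u, continuous p2 u) by (intros u; eapply is_derive_continuous, Dp2).
  assert (Cd : forall u, continuous (fun u => p u * var_density X Y k U V u) u).
  { intros u. apply continuous_Rmult; [apply Cp|].
    now apply continuous_var_density. }
  assert (Cq : forall u, continuous (fun u => 2 * (p u * (p2 u * p2 u))) u).
  { intros u.
    refine (continuous_Rmult _ _ _ (continuous_const 2 u)
      (continuous_Rmult _ _ _ (Cp u) (continuous_Rmult _ _ _ (Cp2 u) (Cp2 u)))). }
  (* The weight [1 / (6 sqrt kappa)] of the first variation is [p / 6]. *)
  assert (I1 : RInt (fun u => p u * var_density X Y k U V u) 0 L = 0).
  { transitivity (6 * RInt (fun u => var_density X Y k U V u / (6 * sqrt (k u))) 0 L);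
      [|rewrite Hcrit; apply Rmult_0_r].
    rewrite <- (RInt_scal (V := R_CompleteNormedModule)).
    - apply (f_equal (fun f => RInt f 0 L)). extensionality u.
      unfold scal; simpl; unfold mult; simpl. unfold p.
      assert (0 < sqrt (k u)) by now apply sqrt_lt_R0.
      refine (_ : @eq R _ _). field. lra.
    - apply (ex_RInt_ext (fun u => / 6 * (p u * var_density X Y k U V u))).
      + intros u _. refine (_ : @eq R _ _). unfold p.
        assert (0 < sqrt (k u)) by now apply sqrt_lt_R0. field. lra.
      + apply ex_RInt_continuous_R. intros u.
        apply continuous_Rmult; [apply continuous_const|apply Cd]. }
  assert (I2 : RInt (fun u => p u * var_density X Y k U V u - 2 * (p u * (p2 u * p2 u))) 0 L = 0).
  (* The derivative of [p var_primitive] exceeds [p var_density] by [p' var_primitive + 3 p kappa'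
     T_1 = 6 p'^2 p'' + 2 p p' p''']; subtracting the derivatives of [4/3 p'^3] and [2 p p' p'']
     leaves [- 2 p p''^2]. *)
  { apply (RInt_derive_periodic (fun u => p u * var_primitive X Y k U V u
      - 4 / 3 * (p1 u * (p1 u * p1 u)) - 2 * (p u * (p1 u * p2 u)))).
    - intros u. eapply is_derive_eq.
      + exact (is_derive_Rminus _ _ _ _ _ (is_derive_Rminus _ _ _ _ _
          (is_derive_Rmult _ _ _ _ _ (Dp u) (is_derive_var_primitive X Y k U V u H HU HV))
          (is_derive_scal _ _ (4 / 3) _ (is_derive_Rmult _ _ _ _ _ (Dp1 u)
             (is_derive_Rmult _ _ _ _ _ (Dp1 u) (Dp1 u)))))
          (is_derive_scal _ _ 2 _ (is_derive_Rmult _ _ _ _ _ (Dp u)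
             (is_derive_Rmult _ _ _ _ _ (Dp1 u) (Dp2 u))))).
      + rewrite Dk. unfold var_primitive. cbv zeta. unfold U, V.
        destruct (jets X HX (fun v => proj1 (H3 v))) as (X1 & X2 & X3).
        destruct (jets Y HY (fun v => proj2 (H3 v))) as (Y1 & Y2 & Y3).
        rewrite (X1 u), (X2 u), (X3 u), (Y1 u), (Y2 u), (Y3 u), Ek.
        (* The density, the only term with fourth derivatives of the field, occurs identically on
           both sides and stays opaque. *)
        clear X1 X2 X3 Y1 Y2 Y3. generalize (var_density X Y k (Derive_n (A X)) (Derive_n (A Y)) u).
        intros B. assert (Hau := Ha u). specialize (Hp0 u).
        change (Derive X u) with (Derive_n X 1 u) in Hau.
        change (Derive Y u) with (Derive_n Y 1 u) in Hau.
        set (x1 := Derive_n X 1 u) in *. set (y1 := Derive_n Y 1 u) in *.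
        set (x2 := Derive_n X 2 u) in *. set (y2 := Derive_n Y 2 u) in *.
        assert (T : forall a b, det2 x1 y1 (a * x2 - b * x1) (a * y2 - b * y1) = a).
        { intros a b. transitivity (a * (x1 * y2 - y1 * x2)); [unfold det2; ring|].
          rewrite Hau. ring. }
        assert (N : forall a b, det2 x2 y2 (a * x2 - b * x1) (a * y2 - b * y1) = b).
        { intros a b. transitivity (b * (x1 * y2 - y1 * x2)); [unfold det2; ring|].
          rewrite Hau. ring. }
        assert (T1 : forall a, det2 x1 y1 (a * x2 - x1) (a * y2 - y1) = a).
        { intros a. transitivity (det2 x1 y1 (a * x2 - 1 * x1) (a * y2 - 1 * y1));
            [f_equal; ring|apply T]. }
        rewrite !T, !N, !T1. field. lra.
    - intros u. apply (continuous_minus (V := R_NormedModule)); [apply Cd|apply Cq].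
    - unfold var_primitive, p1, p2, U, V. rewrite <- (Rplus_0_l L), Perp, Perk.
      assert (PA : forall u, A X (u + L) = A X u /\ A Y (u + L) = A Y u).
      { intros u. unfold A. rewrite Perp.
        now rewrite !(Derive_n_periodic X L), !(Derive_n_periodic Y L) by (auto; apply PXY). }
      now rewrite !(Derive_n_periodic X L), !(Derive_n_periodic Y L),
        !(Derive_n_periodic p L), !(Derive_n_periodic (A X) L), !(Derive_n_periodic (A Y) L)
        by (auto; try apply PXY; apply PA). }
  (* By [I1] and [I2] the nonnegative function [2 p p''^2] has integral zero. *)
  assert (Z : forall u, 0 <= u < L -> p2 u = 0).
  { intros u Hu.
    assert (E : 2 * (p u * (p2 u * p2 u)) = 0).
    { apply (RInt_nonneg_eq_0 (fun u => 2 * (p u * (p2 u * p2 u))) L); auto.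
      - intros v _. specialize (Hp0 v). assert (0 <= p2 v * p2 v) by nra.
        assert (0 <= p v * (p2 v * p2 v)) by now apply Rmult_le_pos; lra. lra.
      - assert (M := RInt_minus (V := R_CompleteNormedModule) _ _ 0 L
          (ex_RInt_continuous_R _ 0 L Cd) (ex_RInt_continuous_R _ 0 L Cq)).
        unfold minus, plus, opp in M; simpl in M.
        change (RInt (fun u => p u * var_density X Y k U V u - 2 * (p u * (p2 u * p2 u))) 0 L
          = RInt (fun u => p u * var_density X Y k U V u) 0 L
            - RInt (fun u => 2 * (p u * (p2 u * p2 u))) 0 L) in M.
        lra. }
    specialize (Hp0 u). assert (p2 u * p2 u = 0) by nra. nra. }
  assert (Z2 : forall u, p2 u = 0).
  { apply (periodic_all L); auto. intros u. unfold p2.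
    now rewrite (Derive_n_periodic p L). }
  assert (C1 : forall u, p1 u = p1 0).
  { intros u. apply is_derive_zero_const. intros v. rewrite <- (Z2 v). apply Dp1. }
  assert (C : p1 0 = 0).
  (* [p] is affine and periodic, so its slope vanishes. *)
  { assert (E : p L - p1 0 * L = p 0 - p1 0 * 0).
    { apply (is_derive_zero_const (fun u => p u - p1 0 * u)). intros v.
      eapply is_derive_eq.
      - exact (is_derive_Rminus _ _ _ _ _ (Dp v) (is_derive_scal _ _ (p1 0) _ (is_derive_id v))).
      - rewrite C1. unfold one; simpl. ring. }
    rewrite <- (Rplus_0_l L), Perp, Rplus_0_l in E. nra. }
  exists (k 0). extensionality u. rewrite !Ek.
  assert (E : p u = p 0); [|now rewrite E].
  apply is_derive_zero_const. intros v. rewrite <- C, <- (C1 v). apply Dp.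
Qed.

(** * Simple closed curves parametrised by the tangent angle *)

Lemma is_derive_continuity_pt (f : R -> R) (x l : R) : is_derive f x l -> continuity_pt f x.
Proof. intros H. apply continuity_pt_filterlim. exact (is_derive_continuous f x l H). Qed.

Lemma derive_pos_lt (f df : R -> R) (a b : R) :
  (forall u, is_derive f u (df u)) -> (forall u, a < u < b -> 0 < df u) ->
  a < b -> f a < f b.
Proof.
  intros Hf Hpos Hab.
  destruct (MVT_cor2 f df a b Hab) as (c & E & Hc).
  - intros c _. apply is_derive_Reals, Hf.
  - specialize (Hpos c Hc). nra.
Qed.

Lemma increasing_inverse (f : R -> R) (a b : R) :
  a < b -> continuity f -> (forall x y, a <= x -> x < y -> y <= b -> f x < f y) ->
  exists g : R -> R,
    (forall z, f a <= z <= f b -> a <= g z <= b /\ f (g z) = z) /\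
    (forall z, f a < z < f b -> continuity_pt g z).
Proof.
  intros Hab Hc Hinc.
  set (g := fun z => epsilon (inhabits 0) (fun x => a <= x <= b /\ f x = z)).
  assert (Hg : forall z, f a <= z <= f b -> a <= g z <= b /\ f (g z) = z).
  { intros z Hz. apply (epsilon_spec (inhabits 0) (fun x => a <= x <= b /\ f x = z)).
    assert (Hfab : f a < f b) by (apply Hinc; lra).
    destruct (IVT_gen f a b z Hc) as (x & Hx & E).
    - rewrite Rmin_left, Rmax_right by lra. exact Hz.
    - rewrite Rmin_left, Rmax_right in Hx by lra. now exists x. }
  exists g. split; [exact Hg|].
  apply (continuity_pt_recip_interv f g a b Hab Hinc); [| |intros; apply Hc].
  - intros z H1 H2. now apply Hg.
  - intros z H1 H2. now apply Hg.
Qed.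

(* Ascending and descending branch are graphs over the ordinate; on the lowest level the descending
   branch lies to the right of the ascending one, near the top it lies to the left. *)
Lemma full_turn_self_crossing (x y r : R -> R) :
  (forall u, 0 < r u) ->
  (forall u, is_derive x u (r u * cos u)) -> (forall u, is_derive y u (r u * sin u)) ->
  y (2 * PI) = y 0 -> x 0 < x (2 * PI) ->
  exists u v, 0 < u < v /\ v < 2 * PI /\ x u = x v /\ y u = y v.
Proof.
  intros Hr Dx Dy Ey Ex.
  assert (Hpi := PI_RGT_0). assert (Hpi4 := PI2_1).
  assert (Cx : continuity x) by (intros u; eapply is_derive_continuity_pt, Dx).
  assert (Cy : continuity y) by (intros u; eapply is_derive_continuity_pt, Dy).
  assert (Up : forall a b, 0 <= a -> a < b -> b <= PI -> y a < y b).
  { intros a b H1 H2 H3. apply (derive_pos_lt y _ a b Dy); [|exact H2].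
    intros u Hu. apply Rmult_lt_0_compat; [apply Hr|apply sin_gt_0; lra]. }
  assert (Down : forall a b, PI <= a -> a < b -> b <= 2 * PI -> - y a < - y b).
  { intros a b H1 H2 H3.
    apply (derive_pos_lt (fun u => - y u) (fun u => r u * - sin u) a b); [| |exact H2].
    - intros u. eapply is_derive_eq; [apply (is_derive_opp y), Dy|].
      unfold opp; simpl. ring.
    - intros u Hu. apply Rmult_lt_0_compat; [apply Hr|].
      assert (sin u < 0) by (apply sin_lt_0; lra). lra. }
  assert (Left : forall a b, PI / 2 <= a -> a < b -> b <= 3 * (PI / 2) -> - x a < - x b).
  { intros a b H1 H2 H3.
    apply (derive_pos_lt (fun u => - x u) (fun u => r u * - cos u) a b); [| |exact H2].
    - intros u. eapply is_derive_eq; [apply (is_derive_opp x), Dx|].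
      unfold opp; simpl. ring.
    - intros u Hu. apply Rmult_lt_0_compat; [apply Hr|].
      assert (cos u < 0) by (apply cos_lt_0; lra). lra. }
  (* [U] inverts the ordinate on the ascending branch and [V] on the descending one, where [- y] is
     increasing. *)
  destruct (increasing_inverse y 0 PI) as (U & HU & CU); [lra|exact Cy|exact Up|].
  destruct (increasing_inverse (fun u => - y u) PI (2 * PI)) as (V' & HV' & CV');
    [lra|intros u; apply continuity_pt_opp, Cy|exact Down|].
  set (V := fun z => V' (- z)).
  set (m := (x (2 * PI) - x 0) / 2).
  assert (Hm : 0 < m) by (unfold m; lra).
  destruct (Cx 0 m Hm) as (d1 & Hd1 & K1).
  destruct (Cx (2 * PI) m Hm) as (d2 & Hd2 & K2).
  (* Within [d] of [0] and of [2 PI] the abscissa changes by less than half of the gap;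
     [d <= 1 < PI / 2] keeps the level [z0] below [z1]. *)
  set (d := Rmin (Rmin (d1 / 2) (d2 / 2)) 1).
  assert (Hd : 0 < d /\ d < d1 /\ d < d2 /\ d <= 1).
  { unfold d. assert (M1 := Rmin_l (Rmin (d1 / 2) (d2 / 2)) 1).
    assert (M2 := Rmin_r (Rmin (d1 / 2) (d2 / 2)) 1).
    assert (M3 := Rmin_l (d1 / 2) (d2 / 2)). assert (M4 := Rmin_r (d1 / 2) (d2 / 2)).
    assert (0 < Rmin (Rmin (d1 / 2) (d2 / 2)) 1) by (repeat apply Rmin_glb_lt; lra). lra. }
  assert (Near : forall p e u, (forall v, D_x no_cond p v /\ Rabs (v - p) < e ->
             Rabs (x v - x p) < m) -> Rabs (u - p) < e -> Rabs (x u - x p) < m).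
  { intros p e u K Hu. destruct (Req_dec u p) as [->|Hne].
    - now rewrite Rminus_diag, Rabs_R0.
    - apply K. repeat split; auto. }
  (* Both levels lie strictly between the extremes, where the inverses are continuous. At [z0] the
     branch points are within [d] of the ends of the turn, so the ascending one is to the left; at
     [z1] both parameters lie in [[PI / 2, 3 PI / 2]], where the abscissa decreases, so it is to the
     right. *)
  set (z0 := Rmin (y d) (y (2 * PI - d))).
  set (z1 := Rmax (y (PI / 2)) (y (3 * (PI / 2)))).
  assert (L1 := Rmin_l (y d) (y (2 * PI - d))). assert (L2 := Rmin_r (y d) (y (2 * PI - d))).
  assert (L3 := Rmax_l (y (PI / 2)) (y (3 * (PI / 2)))).
  assert (L4 := Rmax_r (y (PI / 2)) (y (3 * (PI / 2)))).
  fold z0 in L1, L2. fold z1 in L3, L4.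
  assert (B0 : y 0 < z0).
  { apply Rmin_glb_lt; [apply Up; lra|].
    rewrite <- Ey. apply Ropp_lt_cancel, Down; lra. }
  assert (B1 : z1 < y PI).
  { apply Rmax_lub_lt; [apply Up; lra|]. apply Ropp_lt_cancel, Down; lra. }
  assert (B : z0 < z1).
  { assert (y d < y (PI / 2)) by (apply Up; lra). lra. }
  assert (HU' : forall z, y 0 < z < y PI -> 0 < U z < PI /\ y (U z) = z).
  { intros z Hz. destruct (HU z) as [[[H1|H1] [H2|H2]] E]; try lra.
    - rewrite H2 in E. lra.
    - rewrite <- H1 in E. lra. }
  assert (HV : forall z, y 0 < z < y PI -> PI < V z < 2 * PI /\ y (V z) = z).
  { intros z Hz. destruct (HV' (- z)) as [[[H1|H1] [H2|H2]] E]; try lra; fold (V z) in *.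
    - lra.
    - rewrite H2 in E. lra.
    - rewrite <- H1 in E. lra. }
  set (E := fun z => x (U z) - x (V z)).
  destruct (IVT_interv E z0 z1) as (z & Hz & Ez).
  - intros z Hz. apply continuity_pt_minus.
    + apply (continuity_pt_comp U x); [apply CU; lra|apply Cx].
    + apply (continuity_pt_comp V x); [|apply Cx].
      apply (continuity_pt_comp Ropp V');
        [apply continuity_pt_opp, continuity_pt_id|apply CV'; lra].
  - exact B.
  - destruct (HU' z0) as [HU0 EU0]; [lra|]. destruct (HV z0) as [HV0 EV0]; [lra|].
    assert (U z0 <= d).
    { apply Rnot_lt_le. intros Hlt. assert (y d < y (U z0)) by (apply Up; lra). lra. }
    assert (2 * PI - d <= V z0).
    { apply Rnot_lt_le. intros Hlt.
      assert (- y (V z0) < - y (2 * PI - d)) by (apply Down; lra). lra. }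
    assert (N1 := Near 0 d1 (U z0) K1 ltac:(apply Rabs_def1; lra)).
    assert (N2 := Near (2 * PI) d2 (V z0) K2 ltac:(apply Rabs_def1; lra)).
    apply Rabs_def2 in N1. apply Rabs_def2 in N2. unfold E, m in *. lra.
  - destruct (HU' z1) as [HU1 EU1]; [lra|]. destruct (HV z1) as [HV1 EV1]; [lra|].
    assert (PI / 2 <= U z1).
    { apply Rnot_lt_le. intros Hlt. assert (y (U z1) < y (PI / 2)) by (apply Up; lra). lra. }
    assert (V z1 <= 3 * (PI / 2)).
    { apply Rnot_lt_le. intros Hlt.
      assert (- y (3 * (PI / 2)) < - y (V z1)) by (apply Down; lra). lra. }
    assert (- x (U z1) < - x (V z1)) by (apply Left; lra). unfold E. lra.
  - destruct (HU' z) as [HUz EUz]; [lra|]. destruct (HV z) as [HVz EVz]; [lra|].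
    exists (U z), (V z). unfold E in Ez. repeat split; lra.
Qed.

Lemma derive_neg_local (f : R -> R) (x l : R) :
  is_derive f x l -> l < 0 ->
  exists d, 0 < d /\ forall h, 0 < h < d -> f (x + h) < f x < f (x - h).
Proof.
  intros Hf Hl. apply is_derive_Reals in Hf.
  destruct (Hf (- l)) as (d & Hd); [lra|].
  exists d. split; [apply cond_pos|]. intros h Hh.
  assert (A : forall k, k <> 0 -> Rabs k < d -> (f (x + k) - f x) / k < 0).
  { intros k Hk Hkd. specialize (Hd k Hk Hkd). apply Rabs_def2 in Hd. lra. }
  split.
  - specialize (A h ltac:(lra) ltac:(apply Rabs_def1; lra)).
    assert (E : f (x + h) - f x = (f (x + h) - f x) / h * h) by (field; lra). nra.
  - specialize (A (- h) ltac:(lra) ltac:(apply Rabs_def1; lra)).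
    assert (E : f (x + - h) - f x = (f (x + - h) - f x) / - h * - h) by (field; lra).
    unfold Rminus at 1. nra.
Qed.

(** If the slope at [b] is negative, [f] is positive just before [b]; the last point up to there
    with [f <= 0] is a zero followed by positive values, where the slope cannot be negative. *)
Lemma zero_with_derive_ge_0 (f df : R -> R) (a b : R) :
  (forall u, is_derive f u (df u)) -> a < b -> f a = 0 -> f b = 0 ->
  exists m, f m = 0 /\ 0 <= df m.
Proof.
  intros Hf Hab Ha Hb.
  destruct (Rle_lt_dec 0 (df b)) as [Hd|Hd]; [now exists b|].
  destruct (derive_neg_local f b (df b) (Hf b) Hd) as (d & Hd0 & Hd1).
  set (b' := b - Rmin (d / 2) ((b - a) / 2)).
  assert (M1 := Rmin_l (d / 2) ((b - a) / 2)). assert (M2 := Rmin_r (d / 2) ((b - a) / 2)).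
  assert (M3 : 0 < Rmin (d / 2) ((b - a) / 2)) by (apply Rmin_glb_lt; lra).
  assert (Hb' : 0 < f b').
  { rewrite <- Hb. apply Hd1. lra. }
  assert (Hab' : a < b') by (unfold b'; lra).
  destruct (completeness (fun x => a <= x <= b' /\ f x <= 0)) as (m & Hub & Hlub).
  { exists b'. intros x Hx. apply Hx. }
  { exists a. lra. }
  assert (Ham : a <= m) by (apply Hub; lra).
  assert (Hmb : m <= b') by (apply Hlub; intros x Hx; apply Hx).
  assert (Cf : continuity_pt f m) by (eapply is_derive_continuity_pt, Hf).
  assert (Hright : forall x, m < x <= b' -> 0 < f x).
  { intros x Hx. apply Rnot_le_lt. intros Hle. assert (x <= m) by (apply Hub; lra). lra. }
  assert (Near : forall e, 0 < e -> exists d, 0 < d /\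
             forall x, Rabs (x - m) < d -> Rabs (f x - f m) < e).
  { intros e He. destruct (Cf e He) as (d' & Hd' & K). exists d'. split; [exact Hd'|].
    intros x Hx. destruct (Req_dec x m) as [->|Hne].
    - now rewrite Rminus_diag, Rabs_R0.
    - apply K. repeat split; auto. }
  assert (Hm0 : f m = 0).
  { destruct (Rtotal_order (f m) 0) as [Hlt|[E|Hgt]]; [|exact E|].
    - destruct (Near (- f m)) as (d' & Hd' & K); [lra|].
      destruct (Rle_lt_or_eq_dec m b' Hmb) as [Hlt'|E']; [|subst m; lra].
      set (x := m + Rmin (d' / 2) (b' - m)).
      assert (N1 := Rmin_l (d' / 2) (b' - m)). assert (N2 := Rmin_r (d' / 2) (b' - m)).
      assert (N3 : 0 < Rmin (d' / 2) (b' - m)) by (apply Rmin_glb_lt; lra).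
      assert (Q := Hright x ltac:(unfold x; lra)).
      specialize (K x ltac:(unfold x; apply Rabs_def1; lra)).
      apply Rabs_def2 in K. lra.
    - destruct (Near (f m)) as (d' & Hd' & K); [lra|].
      assert (m <= m - d' / 2); [|lra].
      apply Hlub. intros x [Hx Hfx]. apply Rnot_lt_le. intros Hlt.
      assert (x <= m) by (apply Hub; lra).
      specialize (K x ltac:(apply Rabs_def1; lra)). apply Rabs_def2 in K. lra. }
  exists m. split; [exact Hm0|].
  apply Rnot_lt_le. intros Hlt.
  destruct (derive_neg_local f m (df m) (Hf m) Hlt) as (e & He & Hl).
  assert (Hmb' : m < b') by (destruct Hmb as [|E]; [assumption|subst m; lra]).
  set (h := Rmin (e / 2) (b' - m)).
  assert (N1 := Rmin_l (e / 2) (b' - m)). assert (N2 := Rmin_r (e / 2) (b' - m)).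
  assert (N3 : 0 < h) by (apply Rmin_glb_lt; lra). fold h in N1, N2.
  assert (Q := Hright (m + h) ltac:(lra)).
  destruct (Hl h ltac:(lra)). lra.
Qed.

(** Turning the plane by [- th] and shifting the parameter by [th] preserves the form
    [c' = r (cos, sin)], so the tangent at [th] may be taken horizontal and at parameter [0]. *)
Lemma is_derive_rotated (x y r : R -> R) (th u : R) :
  (forall u, is_derive x u (r u * cos u)) -> (forall u, is_derive y u (r u * sin u)) ->
  is_derive (fun u => cos th * x (th + u) + sin th * y (th + u)) u (r (th + u) * cos u) /\
  is_derive (fun u => cos th * y (th + u) - sin th * x (th + u)) u (r (th + u) * sin u).
Proof.
  intros Dx Dy.
  assert (sh : forall (f df : R -> R), (forall u, is_derive f u (df u)) ->
            is_derive (fun u => f (th + u)) u (df (th + u))).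
  { intros f df Hf. eapply is_derive_eq.
    - apply (is_derive_comp f (fun u => th + u)); [apply Hf|].
      exact (is_derive_Rplus _ _ _ _ _ (is_derive_const th u) (is_derive_id u)).
    - unfold scal, zero, one; simpl; unfold mult; simpl. ring. }
  assert (C : cos u = cos (th + u) * cos th + sin (th + u) * sin th).
  { rewrite <- cos_minus. f_equal. ring. }
  assert (S : sin u = sin (th + u) * cos th - cos (th + u) * sin th).
  { rewrite <- sin_minus. f_equal. ring. }
  split.
  - eapply is_derive_eq.
    + exact (is_derive_Rplus _ _ _ _ _ (is_derive_scal _ _ (cos th) _ (sh x _ Dx))
               (is_derive_scal _ _ (sin th) _ (sh y _ Dy))).
    + rewrite C. ring.
  - eapply is_derive_eq.
    + exact (is_derive_Rminus _ _ _ _ _ (is_derive_scal _ _ (cos th) _ (sh y _ Dy))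
               (is_derive_scal _ _ (sin th) _ (sh x _ Dx))).
    + rewrite S. ring.
Qed.

(* With the support function [h = x sin - y cos], a zero of [D th = h (th + 2 PI) - h th] is a common
   oriented tangent at [th] and [th + 2 PI]; by [full_turn_self_crossing] the later point lies behind
   the earlier one there, so [D] could only ever cross zero downwards, against periodicity. *)
Lemma simple_closed_turning_le (x y r : R -> R) (P : R) :
  0 < P -> (forall u, 0 < r u) ->
  (forall u, is_derive x u (r u * cos u)) -> (forall u, is_derive y u (r u * sin u)) ->
  (forall u, x (u + P) = x u /\ y (u + P) = y u) ->
  (forall u, cos (u + P) = cos u /\ sin (u + P) = sin u) ->
  (forall a b, a < b < a + P -> x a = x b -> y a = y b -> False) ->
  P <= 2 * PI.
Proof.
  intros HP Hr Dx Dy Per Ptrig Hsimple.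
  apply Rnot_lt_le. intros Hlt. assert (Hpi := PI_RGT_0).
  set (h := fun u => x u * sin u - y u * cos u).
  set (dh := fun u => x u * cos u + y u * sin u).
  assert (Dh : forall u, is_derive h u (dh u)).
  { intros u. eapply is_derive_eq.
    - exact (is_derive_Rminus _ _ _ _ _ (is_derive_Rmult _ _ _ _ _ (Dx u) (is_derive_sin u))
        (is_derive_Rmult _ _ _ _ _ (Dy u) (is_derive_cos u))).
    - unfold dh. ring. }
  assert (Ph : forall u, h (u + P) = h u).
  { intros u. unfold h. destruct (Per u) as [-> ->], (Ptrig u) as [-> ->]. reflexivity. }
  set (D := fun u => h (u + 2 * PI) - h u).
  set (dD := fun u => dh (u + 2 * PI) - dh u).
  assert (DD : forall u, is_derive D u (dD u)).
  { intros u. apply is_derive_Rminus; [|apply Dh]. eapply is_derive_eq.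
    - apply (is_derive_comp h (fun u => u + 2 * PI)); [apply Dh|].
      exact (is_derive_Rplus _ _ _ _ _ (is_derive_id u) (is_derive_const (2 * PI) u)).
    - unfold scal, zero, one; simpl; unfold mult; simpl. ring. }
  assert (Ch : forall u, continuity_pt h u) by (intros u; eapply is_derive_continuity_pt, Dh).
  destruct (continuity_ab_maj h 0 P) as (sM & HM & _); [lra|intros; apply Ch|].
  destruct (continuity_ab_min h 0 P) as (sm & Hm & _); [lra|intros; apply Ch|].
  assert (HM' : forall u, h u <= h sM).
  { apply (periodic_all P); [exact HP| |intros u Hu; apply HM; lra].
    intros u. now rewrite Ph. }
  assert (Hm' : forall u, h sm <= h u).
  { apply (periodic_all P); [exact HP| |intros u Hu; apply Hm; lra].
    intros u. now rewrite Ph. }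
  (* [D] is nonpositive at a maximum of [h] and nonnegative at a minimum, so it has a zero;
     periodicity repeats that zero at distance [P]. *)
  destruct (IVT_gen D sM sm 0) as (t0 & _ & Ht0).
  { intros u. eapply is_derive_continuity_pt, DD. }
  { assert (D sM <= 0) by (unfold D; specialize (HM' (sM + 2 * PI)); lra).
    assert (0 <= D sm) by (unfold D; specialize (Hm' (sm + 2 * PI)); lra).
    split; [eapply Rle_trans; [apply Rmin_l|assumption]
           |eapply Rle_trans; [|apply Rmax_r]; assumption]. }
  destruct (zero_with_derive_ge_0 D dD t0 (t0 + P)) as (t & Ht & Hdt);
    [exact DD|lra|exact Ht0| |].
  { unfold D. replace (t0 + P + 2 * PI) with (t0 + 2 * PI + P) by ring. now rewrite !Ph. }
  unfold D, h in Ht. unfold dD, dh in Hdt.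
  rewrite sin_plus, cos_plus, sin_2PI, cos_2PI in Ht, Hdt.
  (* In the frame with horizontal tangent at [t], [Ht] says that the points at [t] and [t + 2 PI]
     have equal height, and [Hdt] that the later one is not behind. If it is ahead, the turn crosses
     itself; if it coincides, it is a double point because [2 PI < P]. *)
  set (X := fun u => cos t * x (t + u) + sin t * y (t + u)).
  set (Y := fun u => cos t * y (t + u) - sin t * x (t + u)).
  assert (EY : Y (2 * PI) = Y 0) by (unfold Y; rewrite Rplus_0_r; lra).
  assert (back : forall u v, X u = X v -> Y u = Y v ->
            x (t + u) = x (t + v) /\ y (t + u) = y (t + v)).
  { intros u v E1 E2. assert (cs := sin2_cos2 t). unfold Rsqr in cs.
    assert (I1 : forall w, x (t + w) = cos t * X w - sin t * Y w).
    { intros w. unfold X, Y. transitivity ((sin t * sin t + cos t * cos t) * x (t + w));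
        [rewrite cs; ring|ring]. }
    assert (I2 : forall w, y (t + w) = sin t * X w + cos t * Y w).
    { intros w. unfold X, Y. transitivity ((sin t * sin t + cos t * cos t) * y (t + w));
        [rewrite cs; ring|ring]. }
    rewrite !I1, !I2, E1, E2. easy. }
  assert (EX : X 0 <= X (2 * PI)) by (unfold X; rewrite Rplus_0_r; lra).
  destruct EX as [EX|EX].
  - destruct (full_turn_self_crossing X Y (fun u => r (t + u))) as (u & v & H1 & H2 & H3 & H4);
      auto.
    + intros u. now apply (is_derive_rotated x y r t u).
    + intros u. now apply (is_derive_rotated x y r t u).
    + destruct (back u v H3 H4). apply (Hsimple (t + u) (t + v)); auto; lra.
  - destruct (back 0 (2 * PI) EX (eq_sym EY)).
    apply (Hsimple (t + 0) (t + 2 * PI)); auto; lra.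
Qed.

(** In the frame of the tangent at [th], the height rises for [u] up to [PI] and falls afterwards,
    as [P <= 2 PI], and it is zero at both ends of the period. *)
Lemma closed_turning_le_support (x y r : R -> R) (P th u : R) :
  P <= 2 * PI -> (forall u, 0 < r u) ->
  (forall u, is_derive x u (r u * cos u)) -> (forall u, is_derive y u (r u * sin u)) ->
  (forall u, x (u + P) = x u /\ y (u + P) = y u) ->
  0 <= u <= P ->
  0 <= cos th * (y (th + u) - y th) - sin th * (x (th + u) - x th).
Proof.
  intros HP Hr Dx Dy Per Hu. assert (Hpi := PI_RGT_0).
  set (Y := fun u => cos th * y (th + u) - sin th * x (th + u)).
  assert (DY : forall u, is_derive Y u (r (th + u) * sin u)).
  { intros v. now apply (is_derive_rotated x y r th v). }
  assert (EP : Y P = Y 0).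
  { unfold Y. destruct (Per th) as [-> ->]. now rewrite Rplus_0_r. }
  assert (Y 0 <= Y u).
  { destruct (Rle_lt_dec u PI) as [Hle|Hgt].
    - destruct (proj1 Hu) as [H0|<-]; [|lra].
      left. apply (derive_pos_lt Y _ 0 u DY); [|exact H0].
      intros v Hv. apply Rmult_lt_0_compat; [apply Hr|apply sin_gt_0; lra].
    - rewrite <- EP. destruct (proj2 Hu) as [H0|H0]; [|rewrite H0; lra].
      left. apply Ropp_lt_cancel.
      apply (derive_pos_lt (fun v => - Y v) (fun v => r (th + v) * - sin v) u P); [| |exact H0].
      + intros v. eapply is_derive_eq; [apply (is_derive_opp Y), DY|].
        unfold opp; simpl. ring.
      + intros v Hv. apply Rmult_lt_0_compat; [apply Hr|].
        assert (sin v < 0) by (apply sin_lt_0; lra). lra. }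
  unfold Y in H. rewrite Rplus_0_r in H. lra.
Qed.

(** * Nonvanishing of the enclosed area *)

Lemma is_derive_inverse (f df g : R -> R) :
  (forall x, is_derive f x (df x)) -> (forall x, 0 < df x) -> (forall z, f (g z) = z) ->
  forall z, is_derive g z (/ df (g z)).
Proof.
  intros Hf Hpos Hg z.
  assert (Hinc : forall x y, x < y -> f x < f y).
  { intros x y Hxy. apply (derive_pos_lt f df); auto. }
  assert (Hginc : forall u v, u <= v -> g u <= g v).
  { intros u v Huv. apply Rnot_lt_le. intros Hlt. apply Hinc in Hlt. rewrite !Hg in Hlt. lra. }
  assert (Hginc' : forall u v, u < v -> g u < g v).
  { intros u v Huv. destruct (Hginc u v) as [Hlt|E]; [lra|exact Hlt|].
    rewrite <- (Hg u), <- (Hg v), E in Huv. lra. }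
  assert (Cg : continuity_pt g z).
  { apply (continuity_pt_recip_interv f g (g (z - 1)) (g (z + 1))).
    - apply Hginc'. lra.
    - intros x y _ Hxy _. now apply Hinc.
    - intros x _ _. apply Hg.
    - intros x. rewrite !Hg. intros H1 H2. split; now apply Hginc.
    - intros a _. eapply is_derive_continuity_pt, Hf.
    - rewrite !Hg. lra. }
  assert (Prf : forall a, g (z - 1) <= a <= g (z + 1) -> derivable_pt f a).
  { intros a _. exists (df a). apply is_derive_Reals, Hf. }
  assert (Hz : g (z - 1) <= g z <= g (z + 1)) by (split; apply Hginc; lra).
  assert (E : derive_pt f (g z) (Prf (g z) Hz) = df (g z)).
  { apply derive_pt_eq_0, is_derive_Reals, Hf. }
  apply is_derive_Reals. rewrite <- E, <- Rdiv_1_l.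
  apply (derivable_pt_lim_recip_interv f g (z - 1) (z + 1) z Prf Cg); try lra.
  - intros x _. apply Hg.
  - rewrite E. apply Rgt_not_eq, Hpos.
Qed.

(** Carries injectivity from the fundamental interval to any window shorter than a period; a pair
    that straddles [L] is brought back by one shift. *)
Lemma simple_closed_neq (L : R) (X Y : R -> R) (a b : R) :
  simple_closed L X Y -> a < b < a + L -> X a = X b -> Y a = Y b -> False.
Proof.
  intros (HL & Per & Hs) Hab EX EY.
  assert (H : forall s d, 0 < d < L -> X s = X (s + d) -> Y s = Y (s + d) -> False).
  { apply (periodic_all L (fun s => forall d, 0 < d < L -> X s = X (s + d) ->
                             Y s = Y (s + d) -> False)); [exact HL| |].
    - intros u. destruct (Per u) as [E1 E2]. rewrite E1, E2.
      split; intros K d Hd; specialize (K d Hd);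
        replace (u + L + d) with (u + d + L) in * by ring;
        destruct (Per (u + d)) as [E3 E4]; now rewrite ?E3, ?E4 in *.
    - intros s Hs' d Hd E1 E2. destruct (Rlt_le_dec (s + d) L) as [Hlt|Hge].
      + assert (s = s + d) by (apply Hs; auto; lra). lra.
      + replace (s + d) with ((s + d - L) + L) in E1, E2 by ring.
        destruct (Per (s + d - L)) as [E3 E4]. rewrite E3 in E1. rewrite E4 in E2.
        assert (s = s + d - L) by (apply Hs; auto; lra). lra. }
  apply (H a (b - a)); [lra| |]; replace (a + (b - a)) with b by ring; assumption.
Qed.

(* Convexity: the point at [0] lies to the left of the oriented tangent at [s]. *)
Lemma simple_arc_support (L : R) (X Y : R -> R) (s : R) :
  smooth1 X -> smooth1 Y -> equiaffine_arclength X Y -> simple_closed L X Y ->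
  0 <= s <= L ->
  0 <= (X s - X 0) * Derive_n Y 1 s - (Y s - Y 0) * Derive_n X 1 s.
Proof.
  intros HX HY Ha Hsc Hs.
  assert (Per := proj1 (proj2 Hsc)). assert (HL := proj1 Hsc).
  set (x1 := Derive_n X 1). set (y1 := Derive_n Y 1).
  set (x2 := Derive_n X 2). set (y2 := Derive_n Y 2).
  assert (DX : forall u, is_derive X u (x1 u)) by (intros u; apply (smooth1_Derive_n X 0 u HX)).
  assert (DY : forall u, is_derive Y u (y1 u)) by (intros u; apply (smooth1_Derive_n Y 0 u HY)).
  assert (Dx1 : forall u, is_derive x1 u (x2 u)) by (intros u; apply (smooth1_Derive_n X 1 u HX)).
  assert (Dy1 : forall u, is_derive y1 u (y2 u)) by (intros u; apply (smooth1_Derive_n Y 1 u HY)).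
  assert (Har : forall u, x1 u * y2 u - y1 u * x2 u = 1) by exact Ha.
  set (n := fun u => x1 u * x1 u + y1 u * y1 u).
  assert (Hn : forall u, 0 < n u).
  { intros u. unfold n. specialize (Har u).
    destruct (Req_dec (x1 u) 0) as [E|E].
    - rewrite E in *. assert (y1 u <> 0) by (intros E'; rewrite E' in Har; lra). nra.
    - nra. }
  set (rho := fun u => sqrt (n u)).
  assert (Hrho : forall u, 0 < rho u) by (intros u; apply sqrt_lt_R0, Hn).
  assert (Hrho2 : forall u, rho u * rho u = n u) by (intros u; apply sqrt_sqrt, Rlt_le, Hn).
  assert (Dn : forall u, is_derive n u (2 * (x1 u * x2 u + y1 u * y2 u))).
  { intros u. eapply is_derive_eq.
    - exact (is_derive_Rplus _ _ _ _ _ (is_derive_Rmult _ _ _ _ _ (Dx1 u) (Dx1 u))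
               (is_derive_Rmult _ _ _ _ _ (Dy1 u) (Dy1 u))).
    - ring. }
  assert (Drho : forall u, is_derive rho u ((x1 u * x2 u + y1 u * y2 u) / rho u)).
  { intros u. eapply is_derive_eq.
    - apply (is_derive_sqrt n u _ (Dn u) (Hn u)).
    - change (sqrt (n u)) with (rho u). specialize (Hrho u). field. lra. }
  (* The tangent angle relative to its value at [0]: its rate is [|c', c''| / |c'|^2 = 1 / n].
     Defining it as an integral avoids lifting an arctangent. *)
  set (psi := fun u => RInt (fun v => / n v) 0 u).
  assert (Cn : forall u, continuous (fun v => / n v) u).
  { intros u. apply (is_derive_continuous _ u (- (2 * (x1 u * x2 u + y1 u * y2 u)) / n u ^ 2)).
    apply is_derive_inv; [apply Dn|]. apply Rgt_not_eq, Hn. }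
  assert (Dpsi : forall u, is_derive psi u (/ n u)).
  { intros u. apply (is_derive_RInt (fun v => / n v) psi 0 u); [|apply Cn].
    apply filter_forall. intros v. apply (RInt_correct (V := R_CompleteNormedModule)).
    now apply ex_RInt_continuous_R. }
  assert (Hn' : forall u, 0 < / n u) by (intros u; apply Rinv_0_lt_compat, Hn).
  assert (psi0 : psi 0 = 0) by apply (RInt_point (V := R_CompleteNormedModule)).
  assert (Dcos : forall u, is_derive (fun v => cos (psi v)) u (- sin (psi u) / n u)).
  { intros u. eapply is_derive_eq.
    - exact (is_derive_comp cos psi u _ _ (is_derive_cos (psi u)) (Dpsi u)).
    - unfold scal; simpl; unfold mult; simpl. unfold Rdiv. ring. }
  assert (Dsin : forall u, is_derive (fun v => sin (psi v)) u (cos (psi u) / n u)).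
  { intros u. eapply is_derive_eq.
    - exact (is_derive_comp sin psi u _ _ (is_derive_sin (psi u)) (Dpsi u)).
    - unfold scal; simpl; unfold mult; simpl. unfold Rdiv. ring. }
  (* [A0] and [B0] are the components of the unit tangent at [0]; [HA] and [HB] say that the unit
     tangent at [u], turned back by [psi u], stays equal to it. *)
  set (A0 := x1 0 / rho 0). set (B0 := y1 0 / rho 0).
  assert (HA : forall u, (x1 u * cos (psi u) + y1 u * sin (psi u)) / rho u = A0).
  { intros u. transitivity ((x1 0 * cos (psi 0) + y1 0 * sin (psi 0)) / rho 0).
    - apply (is_derive_zero_const
        (fun v => (x1 v * cos (psi v) + y1 v * sin (psi v)) / rho v)).
      intros v. eapply is_derive_eq.
      + exact (is_derive_div _ _ _ _ _ (is_derive_Rplus _ _ _ _ _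
          (is_derive_Rmult _ _ _ _ _ (Dx1 v) (Dcos v))
          (is_derive_Rmult _ _ _ _ _ (Dy1 v) (Dsin v))) (Drho v) (Rgt_not_eq _ _ (Hrho v))).
      + assert (Hv := Hrho v). assert (Hnv := Hn v). rewrite <- (Hrho2 v).
        transitivity ((((x2 v * cos (psi v) + y2 v * sin (psi v)) * (rho v * rho v)
           - (x1 v * sin (psi v) - y1 v * cos (psi v)) * 1
           - (x1 v * cos (psi v) + y1 v * sin (psi v)) * (x1 v * x2 v + y1 v * y2 v)))
           / rho v ^ 3); [field; lra|].
        rewrite Hrho2, <- (Har v). unfold n. field. lra.
    - rewrite psi0, cos_0, sin_0. unfold A0. f_equal. ring. }
  assert (HB : forall u, (y1 u * cos (psi u) - x1 u * sin (psi u)) / rho u = B0).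
  { intros u. transitivity ((y1 0 * cos (psi 0) - x1 0 * sin (psi 0)) / rho 0).
    - apply (is_derive_zero_const
        (fun v => (y1 v * cos (psi v) - x1 v * sin (psi v)) / rho v)).
      intros v. eapply is_derive_eq.
      + exact (is_derive_div _ _ _ _ _ (is_derive_Rminus _ _ _ _ _
          (is_derive_Rmult _ _ _ _ _ (Dy1 v) (Dcos v))
          (is_derive_Rmult _ _ _ _ _ (Dx1 v) (Dsin v))) (Drho v) (Rgt_not_eq _ _ (Hrho v))).
      + assert (Hv := Hrho v). assert (Hnv := Hn v). rewrite <- (Hrho2 v).
        transitivity ((((y2 v * cos (psi v) - x2 v * sin (psi v)) * (rho v * rho v)
           - (y1 v * sin (psi v) + x1 v * cos (psi v)) * 1
           - (y1 v * cos (psi v) - x1 v * sin (psi v)) * (x1 v * x2 v + y1 v * y2 v)))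
           / rho v ^ 3); [field; lra|].
        rewrite Hrho2, <- (Har v). unfold n. field. lra.
    - rewrite psi0, cos_0, sin_0. unfold B0. f_equal. ring. }
  assert (cs : forall a, cos a * cos a = 1 - sin a * sin a).
  { intros a. assert (E := sin2_cos2 a). unfold Rsqr in E. lra. }
  assert (Hx1 : forall u, x1 u = rho u * (A0 * cos (psi u) - B0 * sin (psi u))).
  { intros u. rewrite <- (HA u) at 1. rewrite <- (HB u). specialize (Hrho u).
    transitivity (x1 u * (cos (psi u) * cos (psi u) + sin (psi u) * sin (psi u)));
      [rewrite cs; ring|field; lra]. }
  assert (Hy1 : forall u, y1 u = rho u * (A0 * sin (psi u) + B0 * cos (psi u))).
  { intros u. rewrite <- (HA u) at 1. rewrite <- (HB u). specialize (Hrho u).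
    transitivity (y1 u * (cos (psi u) * cos (psi u) + sin (psi u) * sin (psi u)));
      [rewrite cs; ring|field; lra]. }
  assert (AB : A0 * A0 + B0 * B0 = 1).
  { unfold A0, B0. specialize (Hrho 0). transitivity (n 0 / (rho 0 * rho 0));
      [unfold n; field; lra|]. rewrite Hrho2. specialize (Hn 0). field. lra. }
  assert (Px1 : forall u, x1 (u + L) = x1 u).
  { intros u. apply Derive_n_periodic; auto. apply Per. }
  assert (Py1 : forall u, y1 (u + L) = y1 u).
  { intros u. apply Derive_n_periodic; auto. apply Per. }
  assert (Pn : forall u, n (u + L) = n u) by (intros u; unfold n; now rewrite Px1, Py1).
  assert (Prho : forall u, rho (u + L) = rho u) by (intros u; unfold rho; now rewrite Pn).
  set (P := psi L).
  assert (Ppsi : forall u, psi (u + L) = psi u + P).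
  { intros u.
    assert (E : psi (u + L) - psi u = psi (0 + L) - psi 0).
    { apply (is_derive_zero_const (fun v => psi (v + L) - psi v)). intros v.
      eapply is_derive_eq.
      - apply is_derive_Rminus; [|apply Dpsi].
        apply (is_derive_comp psi (fun v => v + L)); [apply Dpsi|].
        exact (is_derive_Rplus _ _ _ _ _ (is_derive_id v) (is_derive_const L v)).
      - rewrite Pn. unfold scal, zero, one; simpl; unfold mult; simpl. ring. }
    rewrite psi0, Rplus_0_l in E. unfold P. lra. }
  assert (Ipsi : forall u v, u < v -> psi u < psi v).
  { intros u v Huv. exact (derive_pos_lt psi _ u v Dpsi (fun w _ => Hn' w) Huv). }
  assert (Jpsi : forall u v, psi u = psi v -> u = v).
  { intros u v E. destruct (Rtotal_order u v) as [Hlt|[|Hlt]]; auto;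
      apply Ipsi in Hlt; lra. }
  assert (HP : 0 < P) by (rewrite <- psi0; apply Ipsi; exact HL).
  (* The inverse of the angle. Surjectivity comes from the intermediate value theorem on one period
     and from [psi (u + L) = psi u + P] elsewhere. *)
  set (sg := fun z => epsilon (inhabits 0) (fun u => psi u = z)).
  assert (Hsg : forall z, psi (sg z) = z).
  { intros z. apply (epsilon_spec (inhabits 0) (fun u => psi u = z)). revert z.
    apply (periodic_all P); [exact HP| |].
    - intros z. split; intros [u Hu].
      + exists (u - L). assert (E := Ppsi (u - L)).
        replace (u - L + L) with u in E by ring. lra.
      + exists (u + L). rewrite Ppsi. lra.
    - intros z Hz. destruct (IVT_gen psi 0 L z) as (u & _ & E).
      + intros v. eapply is_derive_continuity_pt, Dpsi.
      + fold P. rewrite psi0, Rmin_left, Rmax_right by lra. lra.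
      + now exists u. }
  assert (Dsg : forall z, is_derive sg z (n (sg z))).
  { intros z. rewrite <- (Rinv_inv (n (sg z))).
    exact (is_derive_inverse psi (fun u => / n u) sg Dpsi Hn' Hsg z). }
  assert (Psg : forall z, sg (z + P) = sg z + L).
  { intros z. apply Jpsi. now rewrite Ppsi, !Hsg. }
  assert (sgpsi : forall u, sg (psi u) = u) by (intros u; apply Jpsi, Hsg).
  (* Parametrised by the angle, the curve has velocity [n c'], of length [rho n]; [x] and [y] are
     coordinates turned so that the tangent at [0] is horizontal. *)
  set (r := fun z => rho (sg z) * n (sg z)).
  set (x := fun z => A0 * X (sg z) + B0 * Y (sg z)).
  set (y := fun z => A0 * Y (sg z) - B0 * X (sg z)).
  assert (Hr : forall z, 0 < r z) by (intros z; now apply Rmult_lt_0_compat).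
  assert (Dxy : forall z, is_derive (fun z => X (sg z)) z (n (sg z) * x1 (sg z)) /\
                          is_derive (fun z => Y (sg z)) z (n (sg z) * y1 (sg z))).
  { intros z. split.
    - exact (is_derive_comp X sg z _ _ (DX (sg z)) (Dsg z)).
    - exact (is_derive_comp Y sg z _ _ (DY (sg z)) (Dsg z)). }
  assert (Dx : forall z, is_derive x z (r z * cos z)).
  { intros z. destruct (Dxy z) as [D1 D2]. eapply is_derive_eq.
    - exact (is_derive_Rplus _ _ _ _ _ (is_derive_scal _ _ A0 _ D1) (is_derive_scal _ _ B0 _ D2)).
    - rewrite Hx1, Hy1, Hsg. unfold r.
      transitivity (n (sg z) * rho (sg z) * cos z * (A0 * A0 + B0 * B0)); [ring|].
      rewrite AB. ring. }
  assert (Dy : forall z, is_derive y z (r z * sin z)).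
  { intros z. destruct (Dxy z) as [D1 D2]. eapply is_derive_eq.
    - exact (is_derive_Rminus _ _ _ _ _ (is_derive_scal _ _ A0 _ D2) (is_derive_scal _ _ B0 _ D1)).
    - rewrite Hx1, Hy1, Hsg. unfold r.
      transitivity (n (sg z) * rho (sg z) * sin z * (A0 * A0 + B0 * B0)); [ring|].
      rewrite AB. ring. }
  assert (Pxy : forall z, x (z + P) = x z /\ y (z + P) = y z).
  { intros z. unfold x, y. rewrite Psg. destruct (Per (sg z)) as [-> ->]. easy. }
  (* Cosine and sine of the angle can be read off from the unit tangent, which is the same after one
     period. *)
  assert (Ptrig : forall z, cos (z + P) = cos z /\ sin (z + P) = sin z).
  { intros z.
    assert (K : forall u, cos (psi u) = (A0 * x1 u + B0 * y1 u) / rho u /\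
                          sin (psi u) = (A0 * y1 u - B0 * x1 u) / rho u).
    { intros u. specialize (Hrho u). rewrite Hx1, Hy1. split.
      - transitivity ((A0 * A0 + B0 * B0) * cos (psi u)); [rewrite AB; ring|field; lra].
      - transitivity ((A0 * A0 + B0 * B0) * sin (psi u)); [rewrite AB; ring|field; lra]. }
    rewrite <- (Hsg z), <- Ppsi.
    destruct (K (sg z)) as [-> ->], (K (sg z + L)) as [-> ->].
    now rewrite Px1, Py1, Prho. }
  assert (back : forall a b, x a = x b -> y a = y b ->
            X (sg a) = X (sg b) /\ Y (sg a) = Y (sg b)).
  { intros a b E1 E2.
    assert (I1 : forall z, X (sg z) = A0 * x z - B0 * y z).
    { intros z. unfold x, y. transitivity ((A0 * A0 + B0 * B0) * X (sg z));
        [rewrite AB; ring|ring]. }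
    assert (I2 : forall z, Y (sg z) = B0 * x z + A0 * y z).
    { intros z. unfold x, y. transitivity ((A0 * A0 + B0 * B0) * Y (sg z));
        [rewrite AB; ring|ring]. }
    rewrite !I1, !I2, E1, E2. easy. }
  assert (Isg : forall a b, a < b -> sg a < sg b).
  { intros a b Hab. apply Rnot_le_lt. intros [Hlt|E].
    - apply Ipsi in Hlt. rewrite !Hsg in Hlt. lra.
    - apply (f_equal psi) in E. rewrite !Hsg in E. lra. }
  assert (turn : P <= 2 * PI).
  { apply (simple_closed_turning_le x y r P); auto.
    intros a b Hab E1 E2. destruct (back a b E1 E2).
    apply (simple_closed_neq L X Y (sg a) (sg b)); auto.
    rewrite <- Psg. split; apply Isg; lra. }
  assert (Hpsis : 0 <= psi s <= P).
  { rewrite <- psi0. unfold P. split.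
    - destruct (proj1 Hs) as [Hlt| <-]; [left; now apply Ipsi|lra].
    - destruct (proj2 Hs) as [Hlt| ->]; [left; now apply Ipsi|lra]. }
  (* The base point is addressed at parameter [L], that is at angle [P], because
     [closed_turning_le_support] looks forward from [psi s]. *)
  assert (Q := closed_turning_le_support x y r P (psi s) (P - psi s) turn Hr Dx Dy Pxy
                 ltac:(lra)).
  replace (psi s + (P - psi s)) with (psi L) in Q by (symmetry; exact (Rplus_minus (psi s) P)).
  unfold x, y in Q. rewrite !sgpsi in Q.
  destruct (Per 0) as [E1 E2]. rewrite Rplus_0_l in E1, E2. rewrite E1, E2 in Q.
  rewrite (Hx1 s), (Hy1 s).
  match type of Q with 0 <= ?q => replace ((X s - X 0) * _ - _) with (rho s * q) by ring end.
  apply Rmult_le_pos; [apply Rlt_le, Hrho|exact Q].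
Qed.

(** The integral of [g = |c - c(0), c'|] is twice the area, the difference being exact. As [g >= 0],
    zero area forces [g = 0] on the period; at [L / 2] then [c - c(0)] is parallel to both [c'] and
    [c''], hence zero, against simplicity. *)
Lemma simple_arc_area_neq_0 (L : R) (X Y : R -> R) :
  smooth1 X -> smooth1 Y -> equiaffine_arclength X Y -> simple_closed L X Y ->
  F_area L X Y <> 0.
Proof.
  intros HX HY Ha Hsc Harea.
  assert (Per := proj1 (proj2 Hsc)). assert (HL := proj1 Hsc).
  assert (DX := fun u => smooth1_Derive_n X 0 u HX : is_derive X u (Derive_n X 1 u)).
  assert (DY := fun u => smooth1_Derive_n Y 0 u HY : is_derive Y u (Derive_n Y 1 u)).
  assert (DX1 := fun u => smooth1_Derive_n X 1 u HX).
  assert (DY1 := fun u => smooth1_Derive_n Y 1 u HY).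
  set (g := fun s => (X s - X 0) * Derive_n Y 1 s - (Y s - Y 0) * Derive_n X 1 s).
  set (dg := fun s => (X s - X 0) * Derive_n Y 2 s - (Y s - Y 0) * Derive_n X 2 s).
  assert (Dg : forall u, is_derive g u (dg u)).
  { intros u. eapply is_derive_eq.
    - exact (is_derive_Rminus _ _ _ _ _
        (is_derive_Rmult _ _ _ _ _
           (is_derive_Rminus _ _ _ _ _ (DX u) (is_derive_const (X 0) u)) (DY1 u))
        (is_derive_Rmult _ _ _ _ _
           (is_derive_Rminus _ _ _ _ _ (DY u) (is_derive_const (Y 0) u)) (DX1 u))).
    - unfold zero, dg; simpl. ring. }
  set (a := fun u => X u * Derive_n Y 1 u - Y u * Derive_n X 1 u).
  set (b := fun u => Y 0 * Derive_n X 1 u - X 0 * Derive_n Y 1 u).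
  assert (Ca : forall u, continuous a u).
  { intros u. eapply is_derive_continuous.
    exact (is_derive_Rminus _ _ _ _ _ (is_derive_Rmult _ _ _ _ _ (DX u) (DY1 u))
             (is_derive_Rmult _ _ _ _ _ (DY u) (DX1 u))). }
  assert (Cb : forall u, continuous b u).
  { intros u. eapply is_derive_continuous.
    exact (is_derive_Rminus _ _ _ _ _ (is_derive_scal _ _ (Y 0) _ (DX1 u))
             (is_derive_scal _ _ (X 0) _ (DY1 u))). }
  assert (I0 : RInt g 0 L = 0).
  { transitivity (RInt (fun u => a u + b u) 0 L).
    { apply (f_equal (fun f => RInt f 0 L)). extensionality u. unfold g, a, b. ring. }
    assert (M := RInt_plus (V := R_CompleteNormedModule) a b 0 L
      (ex_RInt_continuous_R a 0 L Ca) (ex_RInt_continuous_R b 0 L Cb)).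
    assert (Ib : RInt b 0 L = 0).
    { apply (RInt_derive_periodic (fun u => Y 0 * X u - X 0 * Y u)); [|exact Cb|].
      - intros u. exact (is_derive_Rminus _ _ _ _ _ (is_derive_scal _ _ (Y 0) _ (DX u))
                           (is_derive_scal _ _ (X 0) _ (DY u))).
      - destruct (Per 0) as [E1 E2]. rewrite Rplus_0_l in E1, E2. now rewrite E1, E2. }
    assert (Ia : RInt a 0 L = 0).
    { unfold F_area in Harea.
      change (/ 2 * RInt a 0 L = 0) in Harea. lra. }
    rewrite Ia, Ib in M. transitivity (0 + 0); [exact M|apply Rplus_0_r]. }
  assert (G0 : forall u, 0 <= u < L -> g u = 0).
  { apply RInt_nonneg_eq_0; [intros u; eapply is_derive_continuous, Dg| |exact I0].
    intros u Hu. now apply (simple_arc_support L). }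
  set (h := L / 2).
  assert (Hh : 0 < h < L) by (unfold h; lra).
  assert (E1 : g h = 0) by (apply G0; lra).
  assert (E2 : dg h = 0).
  { rewrite <- (is_derive_unique _ _ _ (Dg h)). apply is_derive_unique.
    apply (is_derive_ext_loc (fun _ => 0)); [|exact (is_derive_const 0 h)].
    exists (mkposreal h (proj1 Hh)). intros v Hv.
    change (Rabs (v - h) < h) in Hv. apply Rabs_def2 in Hv.
    symmetry. apply G0. unfold h in *. lra. }
  assert (Hah := Ha h).
  change (Derive X h) with (Derive_n X 1 h) in Hah.
  change (Derive Y h) with (Derive_n Y 1 h) in Hah.
  unfold g in E1. unfold dg in E2.
  apply (simple_closed_neq L X Y 0 h Hsc); [lra| |]; symmetry; apply Rminus_diag_uniq.
  - transitivity ((X h - X 0) * (Derive_n X 1 h * Derive_n Y 2 h - Derive_n Y 1 h * Derive_n X 2 h));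
      [rewrite Hah; ring|].
    transitivity (Derive_n X 1 h * ((X h - X 0) * Derive_n Y 2 h - (Y h - Y 0) * Derive_n X 2 h)
      - Derive_n X 2 h * ((X h - X 0) * Derive_n Y 1 h - (Y h - Y 0) * Derive_n X 1 h));
      [ring|rewrite E1, E2; ring].
  - transitivity ((Y h - Y 0) * (Derive_n X 1 h * Derive_n Y 2 h - Derive_n Y 1 h * Derive_n X 2 h));
      [rewrite Hah; ring|].
    transitivity (Derive_n Y 1 h * ((X h - X 0) * Derive_n Y 2 h - (Y h - Y 0) * Derive_n X 2 h)
      - Derive_n Y 2 h * ((X h - X 0) * Derive_n Y 1 h - (Y h - Y 0) * Derive_n X 1 h));
      [ring|rewrite E1, E2; ring].
Qed.

(** * Dilations and ellipses *)

Lemma first_var_eq (F : (R -> R) -> (R -> R) -> R) (GX GY : R -> R -> R)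
    (f : R -> R) (eps l : R) :
  0 < eps -> (forall t, Rabs t < eps -> F (GX t) (GY t) = f t) -> is_derive f 0 l ->
  first_var F GX GY = l.
Proof.
  intros Heps E Hf. apply is_derive_unique.
  apply (is_derive_ext_loc f); [|exact Hf].
  exists (mkposreal eps Heps). intros t Ht. symmetry. apply E.
  change (Rabs (t - 0) < eps) in Ht. now rewrite Rminus_0_r in Ht.
Qed.

Lemma aphi_scale (c : R) (X Y : R -> R) (u : R) :
  aphi (fun u => c * X u) (fun u => c * Y u) u = c ^ 2 * aphi X Y u.
Proof.
  assert (D : forall Z, Derive (fun u => c * Z u) = fun u => c * Derive Z u)
    by (intros Z; extensionality v; apply Derive_scal).
  unfold aphi. rewrite !D. ring.
Qed.

Lemma curve_q_scale (c : R) (X Y : R -> R) (u : R) :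
  c <> 0 -> aphi X Y u <> 0 ->
  curve_q (fun u => c * X u) (fun u => c * Y u) u = curve_q X Y u.
Proof.
  intros Hc Hphi. unfold curve_q, jet_q. rewrite !Derive_n_scal_l.
  change (Derive_n X 1 u * Derive_n Y 2 u - Derive_n Y 1 u * Derive_n X 2 u <> 0) in Hphi.
  field. split; [exact Hphi|].
  replace (c * Derive_n X 1 u * (c * Derive_n Y 2 u) - c * Derive_n Y 1 u * (c * Derive_n X 2 u))
    with (c * c * (Derive_n X 1 u * Derive_n Y 2 u - Derive_n Y 1 u * Derive_n X 2 u)) by ring.
  now repeat apply Rmult_integral_contrapositive_currified.
Qed.

(* [lambda = 0] for all three constraints: the integral of [sqrt kappa] is invariant under dilations
   while the constraint functionals are homogeneous of nonzero degree. *)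
Lemma first_var_dilation (L : R) (X Y k : R -> R) :
  0 < L -> arc_curve X Y k -> (forall u, X (u + L) = X u /\ Y (u + L) = Y u) ->
  let GX := fun t u => X u + t * X u in
  let GY := fun t u => Y u + t * Y u in
  variation L X Y GX GY /\
  first_var (F_sqrtk L) GX GY = 0 /\
  first_var (F_area L) GX GY = 2 * F_area L X Y /\
  first_var (F_length L) GX GY = 2 / 3 * L /\
  first_var (F_totcurv L) GX GY = - (2 / 3) * RInt k 0 L.
Proof.
  intros HL H PXY GX GY.
  assert (HX : smooth1 X) by apply H. assert (HY : smooth1 Y) by apply H.
  assert (Hk : forall u, 0 < k u) by apply H.
  assert (Ck : forall u, continuous k u).
  { intros u. destruct H as (_ & _ & Sk & _).
    exact (is_derive_continuous k u _ (smooth1_Derive_n k 0 u Sk)). }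
  assert (HG : variation L X Y GX GY).
  { apply variation_affine; auto. now apply (arc_curve_pos_curved X Y k). }
  assert (EX : forall t, GX t = fun u => (1 + t) * X u)
    by (intros t; extensionality u; unfold GX; ring).
  assert (EY : forall t, GY t = fun u => (1 + t) * Y u)
    by (intros t; extensionality u; unfold GY; ring).
  (* The line element scales by [m], since [aphi] is quadratic in the curve, and [akappa] by [m^-2];
     this yields the weights [2/3] of the length and [- 2/3] of the total curvature. *)
  set (m := fun t => Rpower ((1 + t) ^ 2) (1 / 3)).
  assert (Hm : forall t, 0 < m t) by (intros t; apply exp_pos).
  assert (m0 : m 0 = 1).
  { unfold m. replace ((1 + 0) ^ 2) with 1 by ring. unfold Rpower.
    rewrite ln_1, Rmult_0_r. apply exp_0. }
  assert (Dm : is_derive m 0 (2 / 3)).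
  { unfold m, Rpower. auto_derive; [lra|].
    simpl. rewrite !Rplus_0_r, !Rmult_1_r, ln_1, Rmult_0_r, exp_0. field. }
  assert (Eads : forall t u, ads (GX t) (GY t) u = m t).
  { intros t u. unfold ads, m. rewrite EX, EY, aphi_scale.
    destruct (arc_curve_curve_q X Y k u H) as [-> _]. now rewrite Rmult_1_r. }
  assert (Ek : forall t, Rabs t < 1 -> forall u, akappa (GX t) (GY t) u = k u / m t ^ 2).
  { intros t Ht u. apply Rabs_def2 in Ht. rewrite akappa_jet.
    - rewrite Eads, EX, EY, curve_q_scale.
      + now destruct (arc_curve_curve_q X Y k u H) as [_ ->].
      + lra.
      + destruct (arc_curve_curve_q X Y k u H) as [-> _]. lra.
    - apply smooth2_slice, HG.
    - apply smooth2_slice, HG.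
    - intros v. rewrite EX, EY, aphi_scale.
      destruct (arc_curve_curve_q X Y k v H) as [-> _]. nra. }
  refine (conj HG (conj _ (conj _ (conj _ _)))).
  - apply (first_var_eq _ _ _ (fun _ => RInt (fun u => sqrt (k u)) 0 L) 1); [lra| |].
    + intros t Ht. apply (f_equal (fun f => RInt f 0 L)). extensionality u.
      rewrite Eads, Ek by exact Ht. specialize (Hm t).
      rewrite sqrt_div_alt by now apply pow_lt. rewrite sqrt_pow2 by lra. field. lra.
    + exact (is_derive_const (RInt (fun u => sqrt (k u)) 0 L : R) 0).
  - apply (first_var_eq _ _ _ (fun t => (1 + t) ^ 2 * F_area L X Y) 1); [lra| |].
    + intros t _. rewrite EX, EY. unfold F_area.
      transitivity (/ 2 * RInt (fun u => (1 + t) ^ 2 * (X u * Derive Y u - Y u * Derive X u)) 0 L).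
      * apply (f_equal (fun f => / 2 * RInt f 0 L)). extensionality u.
        rewrite !Derive_scal. ring.
      * assert (M := RInt_scal (V := R_CompleteNormedModule)
          (fun u => X u * Derive Y u - Y u * Derive X u) 0 L ((1 + t) ^ 2)).
        unfold scal in M; simpl in M; unfold mult in M; simpl in M.
        simpl. rewrite M; [ring|].
        apply ex_RInt_continuous_R. intros u. eapply is_derive_continuous.
        exact (is_derive_Rminus _ _ _ _ _
          (is_derive_Rmult _ _ _ _ _ (smooth1_Derive_n X 0 u HX) (smooth1_Derive_n Y 1 u HY))
          (is_derive_Rmult _ _ _ _ _ (smooth1_Derive_n Y 0 u HY) (smooth1_Derive_n X 1 u HX))).
    + auto_derive; [easy|ring].
  - apply (first_var_eq _ _ _ (fun t => m t * L) 1); [lra| |].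
    + intros t _. unfold F_length.
      transitivity (RInt (fun _ => m t) 0 L).
      * apply (f_equal (fun f => RInt f 0 L)). extensionality u. apply Eads.
      * rewrite RInt_const. unfold scal; simpl; unfold mult; simpl. ring.
    + eapply is_derive_eq.
      * exact (is_derive_Rmult _ _ _ _ _ Dm (is_derive_const L 0)).
      * unfold zero; simpl. ring.
  - apply (first_var_eq _ _ _ (fun t => / m t * RInt k 0 L) 1); [lra| |].
    + intros t Ht. unfold F_totcurv.
      transitivity (RInt (fun u => scal (/ m t) (k u)) 0 L).
      * apply (f_equal (fun f => RInt f 0 L)). extensionality u.
        rewrite Eads, Ek by exact Ht. specialize (Hm t).
        unfold scal; simpl; unfold mult; simpl. field. lra.
      * apply (RInt_scal (V := R_CompleteNormedModule)). now apply ex_RInt_continuous_R.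
    + assert (Hm0 : m 0 <> 0) by (rewrite m0; lra).
      eapply is_derive_eq.
      * exact (is_derive_Rmult _ _ _ _ _ (is_derive_inv m 0 _ Dm Hm0)
                 (is_derive_const (RInt k 0 L : R) 0)).
      * unfold zero; simpl. rewrite m0. field.
Qed.

(** * Ellipses and constant equi-affine curvature *)

Lemma const_curvature_ellipse (k0 : R) (X Y : R -> R) :
  arc_curve X Y (fun _ => k0) -> is_ellipse X Y.
Proof.
  intros (HX & HY & _ & Hk & Ha & H3).
  assert (Hk0 : 0 < k0) by exact (Hk 0).
  set (w := sqrt k0). assert (Hw : 0 < w) by now apply sqrt_lt_R0.
  assert (Ew : k0 = w * w) by (symmetry; apply sqrt_sqrt; lra).
  assert (Dcos : forall s, is_derive (fun s => cos (w * s)) s (- w * sin (w * s)))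
    by (intros s; auto_derive; [easy|ring]).
  assert (Dsin : forall s, is_derive (fun s => sin (w * s)) s (w * cos (w * s)))
    by (intros s; auto_derive; [easy|ring]).
  (* First integrals take the place of a uniqueness theorem for the differential equation:
     [Z + Z'' / k0] is constant, and so is the vector with components [Z'] and [Z'' / w] turned by
     the angle [w s]. *)
  assert (solve : forall Z, smooth1 Z ->
    (forall s, Derive_n Z 3 s = - k0 * Derive_n Z 1 s) ->
    exists e, forall s, Z s = - (Derive_n Z 2 0 / w ^ 2) * cos (w * s)
                              + Derive_n Z 1 0 / w * sin (w * s) + e).
  { intros Z HZ E3. exists (Z 0 + Derive_n Z 2 0 / k0). intros s.
    assert (D0 := fun s => smooth1_Derive_n Z 0 s HZ : is_derive Z s (Derive_n Z 1 s)).
    assert (D1 := fun s => smooth1_Derive_n Z 1 s HZ).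
    assert (D2 := fun s => smooth1_Derive_n Z 2 s HZ).
    assert (C0 : Z s + / k0 * Derive_n Z 2 s = Z 0 + / k0 * Derive_n Z 2 0).
    { apply (is_derive_zero_const (fun s => Z s + / k0 * Derive_n Z 2 s)). intros v.
      eapply is_derive_eq.
      - exact (is_derive_Rplus _ _ _ _ _ (D0 v) (is_derive_scal _ _ (/ k0) _ (D2 v))).
      - rewrite E3. field. lra. }
    assert (C1 : Derive_n Z 1 s * cos (w * s) - / w * Derive_n Z 2 s * sin (w * s)
               = Derive_n Z 1 0 * cos (w * 0) - / w * Derive_n Z 2 0 * sin (w * 0)).
    { apply (is_derive_zero_const
        (fun s => Derive_n Z 1 s * cos (w * s) - / w * Derive_n Z 2 s * sin (w * s))).
      intros v. eapply is_derive_eq.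
      - exact (is_derive_Rminus _ _ _ _ _ (is_derive_Rmult _ _ _ _ _ (D1 v) (Dcos v))
          (is_derive_Rmult _ _ _ _ _ (is_derive_scal _ _ (/ w) _ (D2 v)) (Dsin v))).
      - rewrite E3, Ew. field. lra. }
    assert (C2 : Derive_n Z 1 s * sin (w * s) + / w * Derive_n Z 2 s * cos (w * s)
               = Derive_n Z 1 0 * sin (w * 0) + / w * Derive_n Z 2 0 * cos (w * 0)).
    { apply (is_derive_zero_const
        (fun s => Derive_n Z 1 s * sin (w * s) + / w * Derive_n Z 2 s * cos (w * s))).
      intros v. eapply is_derive_eq.
      - exact (is_derive_Rplus _ _ _ _ _ (is_derive_Rmult _ _ _ _ _ (D1 v) (Dsin v))
          (is_derive_Rmult _ _ _ _ _ (is_derive_scal _ _ (/ w) _ (D2 v)) (Dcos v))).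
      - rewrite E3, Ew. field. lra. }
    rewrite Rmult_0_r, cos_0, sin_0 in C1, C2.
    assert (cs := sin2_cos2 (w * s)). unfold Rsqr in cs.
    assert (EZ2 : Derive_n Z 2 s = Derive_n Z 2 0 * cos (w * s) - w * Derive_n Z 1 0 * sin (w * s)).
    { transitivity (w * ((Derive_n Z 1 s * sin (w * s) + / w * Derive_n Z 2 s * cos (w * s))
                           * cos (w * s)
        - (Derive_n Z 1 s * cos (w * s) - / w * Derive_n Z 2 s * sin (w * s)) * sin (w * s))).
      - transitivity (Derive_n Z 2 s * (sin (w * s) * sin (w * s) + cos (w * s) * cos (w * s)));
          [rewrite cs; ring|field; lra].
      - rewrite C1, C2. field. lra. }
    assert (E : Z s = Z 0 + / k0 * Derive_n Z 2 0 - / k0 * Derive_n Z 2 s) by lra.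
    rewrite E, EZ2, Ew. field. lra. }
  destruct (solve X HX (fun s => proj1 (H3 s))) as (e & He).
  destruct (solve Y HY (fun s => proj2 (H3 s))) as (f & Hf).
  (* The determinant of these coefficients is [|c', c''| / w^3] at [0]. *)
  exists (- (Derive_n X 2 0 / w ^ 2)), (Derive_n X 1 0 / w),
    (- (Derive_n Y 2 0 / w ^ 2)), (Derive_n Y 1 0 / w), e, f.
  assert (Ha0 := Ha 0).
  change (Derive X 0) with (Derive_n X 1 0) in Ha0.
  change (Derive Y 0) with (Derive_n Y 1 0) in Ha0.
  repeat split.
  - replace (- (Derive_n X 2 0 / w ^ 2) * (Derive_n Y 1 0 / w) -
             Derive_n X 1 0 / w * - (Derive_n Y 2 0 / w ^ 2))
      with ((Derive_n X 1 0 * Derive_n Y 2 0 - Derive_n Y 1 0 * Derive_n X 2 0) / w ^ 3)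
      by (field; lra).
    rewrite Ha0. apply Rgt_not_eq, Rdiv_lt_0_compat; [lra|now apply pow_lt].
  - intros s. exists (w * s). split; [apply He|apply Hf].
  - intros th. exists (th / w). rewrite He, Hf.
    replace (w * (th / w)) with th by (field; lra). easy.
Qed.

(* In the affine coordinates [(p, q)] where the ellipse is the unit circle, the angular speed
   [w = p q' - q p'] satisfies [w^3 = / delta], so it is constant and [kappa = w^2]. *)
Lemma ellipse_const_curvature (X Y k : R -> R) :
  arc_curve X Y k -> is_ellipse X Y -> exists k0, k = fun _ => k0.
Proof.
  intros (HX & HY & _ & _ & Ha & H3) (a & b & c & d & e & f & Hdet & Hon & _).
  set (delta := a * d - b * c) in *.
  (* [lp n] and [lq n] apply the linear part of the inverse affine map to the [n]-th derivative of
     the curve: for [n >= 1] they are the derivatives of [p] and [q], for [n = 0] they miss the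
     translation. *)
  set (lp := fun (n : nat) s => (d * Derive_n X n s - b * Derive_n Y n s) / delta).
  set (lq := fun (n : nat) s => (a * Derive_n Y n s - c * Derive_n X n s) / delta).
  set (p := fun s => (d * (X s - e) - b * (Y s - f)) / delta).
  set (q := fun s => (a * (Y s - f) - c * (X s - e)) / delta).
  assert (Dl : forall (n : nat) s, is_derive (lp n) s (lp (S n) s) /\ is_derive (lq n) s (lq (S n) s)).
  { intros n s.
    assert (D1 := smooth1_Derive_n X n s HX). assert (D2 := smooth1_Derive_n Y n s HY).
    split.
    - apply (is_derive_ext (fun s => / delta * (d * Derive_n X n s - b * Derive_n Y n s)));
        [intros t; unfold lp, Rdiv; apply Rmult_comm|].
      eapply is_derive_eq.
      + exact (is_derive_scal _ _ (/ delta) _ (is_derive_Rminus _ _ _ _ _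
          (is_derive_scal _ _ d _ D1) (is_derive_scal _ _ b _ D2))).
      + unfold lp, Rdiv. apply Rmult_comm.
    - apply (is_derive_ext (fun s => / delta * (a * Derive_n Y n s - c * Derive_n X n s)));
        [intros t; unfold lq, Rdiv; apply Rmult_comm|].
      eapply is_derive_eq.
      + exact (is_derive_scal _ _ (/ delta) _ (is_derive_Rminus _ _ _ _ _
          (is_derive_scal _ _ a _ D2) (is_derive_scal _ _ c _ D1))).
      + unfold lq, Rdiv. apply Rmult_comm. }
  assert (Dp : forall s, is_derive p s (lp 1%nat s)).
  { intros s. apply (is_derive_ext (fun s => lp 0%nat s + (b * f - d * e) / delta)).
    - intros t. unfold lp, p. simpl. field. exact Hdet.
    - eapply is_derive_eq.
      + exact (is_derive_Rplus _ _ _ _ _ (proj1 (Dl 0%nat s)) (is_derive_const _ s)).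
      + apply Rplus_0_r. }
  assert (Dq : forall s, is_derive q s (lq 1%nat s)).
  { intros s. apply (is_derive_ext (fun s => lq 0%nat s + (c * e - a * f) / delta)).
    - intros t. unfold lq, q. simpl. field. exact Hdet.
    - eapply is_derive_eq.
      + exact (is_derive_Rplus _ _ _ _ _ (proj2 (Dl 0%nat s)) (is_derive_const _ s)).
      + apply Rplus_0_r. }
  assert (circle : forall s, p s * p s + q s * q s = 1).
  { intros s. destruct (Hon s) as (th & E1 & E2). unfold p, q. rewrite E1, E2.
    assert (cs := sin2_cos2 th). unfold Rsqr in cs. rewrite <- cs. unfold delta in *.
    field. exact Hdet. }
  assert (tangent : forall s, p s * lp 1%nat s + q s * lq 1%nat s = 0).
  { intros s.
    assert (E : 2 * (p s * lp 1%nat s + q s * lq 1%nat s) = 0); [|lra].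
    transitivity (Derive (fun s => p s * p s + q s * q s) s).
    - symmetry. apply is_derive_unique. eapply is_derive_eq.
      + exact (is_derive_Rplus _ _ _ _ _ (is_derive_Rmult _ _ _ _ _ (Dp s) (Dp s))
                 (is_derive_Rmult _ _ _ _ _ (Dq s) (Dq s))).
      + ring.
    - rewrite (Derive_ext _ _ _ circle). apply Derive_const. }
  assert (accel : forall s, lp 1%nat s * lp 1%nat s + p s * lp 2%nat s
                   + lq 1%nat s * lq 1%nat s + q s * lq 2%nat s = 0).
  { intros s.
    transitivity (Derive (fun s => p s * lp 1%nat s + q s * lq 1%nat s) s).
    - symmetry. apply is_derive_unique. eapply is_derive_eq.
      + exact (is_derive_Rplus _ _ _ _ _
          (is_derive_Rmult _ _ _ _ _ (Dp s) (proj1 (Dl 1%nat s)))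
          (is_derive_Rmult _ _ _ _ _ (Dq s) (proj2 (Dl 1%nat s)))).
      + ring.
    - rewrite (Derive_ext _ _ _ tangent). apply Derive_const. }
  set (w := fun s => p s * lq 1%nat s - q s * lp 1%nat s).
  assert (Ep1 : forall s, lp 1%nat s = - w s * q s).
  { intros s. unfold w.
    transitivity (lp 1%nat s * (p s * p s + q s * q s) - p s * (p s * lp 1%nat s + q s * lq 1%nat s));
      [rewrite circle, tangent; ring|ring]. }
  assert (Eq1 : forall s, lq 1%nat s = w s * p s).
  { intros s. unfold w.
    transitivity (lq 1%nat s * (p s * p s + q s * q s) - q s * (p s * lp 1%nat s + q s * lq 1%nat s));
      [rewrite circle, tangent; ring|ring]. }
  (* On the unit circle [p' = - w q] and [q' = w p], so [p' q'' - q' p'' = w^3]; the inverse affine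
     map scales the arc-length determinant 1 to [/ delta]. *)
  assert (cube : forall s, w s * (w s * w s) = / delta).
  { intros s.
    assert (E1 : lp 1%nat s * lq 2%nat s - lq 1%nat s * lp 2%nat s = / delta).
    { specialize (Ha s). unfold lp, lq.
      transitivity ((Derive_n X 1 s * Derive_n Y 2 s - Derive_n Y 1 s * Derive_n X 2 s) / delta).
      - unfold delta in *. field. exact Hdet.
      - change (Derive_n X 1 s) with (Derive X s). change (Derive_n Y 1 s) with (Derive Y s).
        rewrite Ha. unfold Rdiv. ring. }
    rewrite <- E1, Ep1, Eq1.
    assert (E2 := accel s). rewrite Ep1, Eq1 in E2.
    assert (E3 : p s * lp 2%nat s + q s * lq 2%nat s = - (w s * w s)).
    { transitivity (- (w s * w s) * (p s * p s + q s * q s)); [lra|rewrite circle; ring]. }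
    transitivity (- w s * (p s * lp 2%nat s + q s * lq 2%nat s)); [rewrite E3; ring|ring]. }
  set (w0 := w 0).
  assert (Ew : forall s, w s = w0).
  { intros s. assert (E := cube s). rewrite <- (cube 0) in E. fold w0 in E.
    (* Real cubes are injective: the second factor is at least [3/4 w0^2], and [w0] is nonzero
       because its cube is [/ delta]. *)
    assert (F : (w s - w0) * (w s * w s + w s * w0 + w0 * w0) = 0) by (ring_simplify; lra).
    apply Rmult_integral in F. destruct F as [F|F]; [lra|].
    assert (w0 <> 0).
    { intros Z. assert (C := cube 0). fold w0 in C. rewrite Z in C.
      apply (Rinv_neq_0_compat _ Hdet). rewrite <- C. ring. }
    assert (0 < w0 * w0) by nra. assert (Q := Rle_0_sqr (w s + w0 / 2)). unfold Rsqr in Q. lra. }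
  assert (Ep2 : forall s, lp 2%nat s = - w0 * lq 1%nat s).
  { intros s. rewrite <- (is_derive_unique _ _ _ (proj1 (Dl 1%nat s))).
    apply is_derive_unique. apply (is_derive_ext (fun s => - w0 * q s)).
    - intros t. now rewrite Ep1, Ew.
    - apply is_derive_scal, Dq. }
  assert (Eq2 : forall s, lq 2%nat s = w0 * lp 1%nat s).
  { intros s. rewrite <- (is_derive_unique _ _ _ (proj2 (Dl 1%nat s))).
    apply is_derive_unique. apply (is_derive_ext (fun s => w0 * p s)).
    - intros t. now rewrite Eq1, Ew.
    - apply is_derive_scal, Dp. }
  assert (Ep3 : forall s, lp 3%nat s = - (w0 * w0) * lp 1%nat s).
  { intros s. rewrite <- (is_derive_unique _ _ _ (proj1 (Dl 2%nat s))).
    apply is_derive_unique. apply (is_derive_ext (fun s => - w0 * lq 1%nat s)).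
    - intros t. now rewrite Ep2.
    - eapply is_derive_eq; [apply is_derive_scal, (Dl 1%nat s)|]. rewrite Eq2. ring. }
  assert (Eq3 : forall s, lq 3%nat s = - (w0 * w0) * lq 1%nat s).
  { intros s. rewrite <- (is_derive_unique _ _ _ (proj2 (Dl 2%nat s))).
    apply is_derive_unique. apply (is_derive_ext (fun s => w0 * lp 1%nat s)).
    - intros t. now rewrite Eq2.
    - eapply is_derive_eq; [apply is_derive_scal, (Dl 1%nat s)|]. rewrite Ep2. ring. }
  exists (w0 * w0). extensionality s.
  assert (IX : forall n, Derive_n X n s = a * lp n s + b * lq n s)
    by (intros n; unfold lp, lq, delta in *; field; exact Hdet).
  assert (IY : forall n, Derive_n Y n s = c * lp n s + d * lq n s)
    by (intros n; unfold lp, lq, delta in *; field; exact Hdet).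
  destruct (H3 s) as [E1 E2].
  (* Since also [c''' = - w0^2 c'], the vector [(kappa - w0^2) c'] vanishes; pairing it with [c'']
     leaves the scalar. *)
  assert (F1 : (k s - w0 * w0) * Derive_n X 1 s = 0).
  { transitivity (- Derive_n X 3 s - w0 * w0 * Derive_n X 1 s); [rewrite E1; ring|].
    rewrite !IX, Ep3, Eq3. ring. }
  assert (F2 : (k s - w0 * w0) * Derive_n Y 1 s = 0).
  { transitivity (- Derive_n Y 3 s - w0 * w0 * Derive_n Y 1 s); [rewrite E2; ring|].
    rewrite !IY, Ep3, Eq3. ring. }
  specialize (Ha s).
  change (Derive X s) with (Derive_n X 1 s) in Ha.
  change (Derive Y s) with (Derive_n Y 1 s) in Ha.
  apply Rminus_diag_uniq.
  transitivity ((k s - w0 * w0) * Derive_n X 1 s * Derive_n Y 2 s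
     - (k s - w0 * w0) * Derive_n Y 1 s * Derive_n X 2 s).
  - transitivity ((k s - w0 * w0) * 1); [ring|rewrite <- Ha; ring].
  - rewrite F1, F2. ring.
Qed.

(** * The four variational problems *)

Theorem theorem7 (L : R) (X Y : R -> R) :
  smooth1 X -> smooth1 Y ->
  simple_closed L X Y ->
  equiaffine_arclength X Y ->
  strictly_pos_curved_al X Y ->
  (critical L (F_sqrtk L) X Y <-> is_ellipse X Y) /\
  (critical_under L (F_sqrtk L) (F_area L) X Y <-> is_ellipse X Y) /\
  (critical_under L (F_sqrtk L) (F_length L) X Y <-> is_ellipse X Y) /\
  (critical_under L (F_sqrtk L) (F_totcurv L) X Y <-> is_ellipse X Y).
Proof.
  intros HX HY Hsc Ha Hpc.
  assert (HL := proj1 Hsc). assert (PXY := proj1 (proj2 Hsc)).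
  destruct (arc_curve_intro X Y HX HY Ha Hpc) as (k & H).
  assert (only : critical L (F_sqrtk L) X Y -> is_ellipse X Y).
  { intros Hc. destruct (critical_curvature_const L X Y k HL H PXY Hc) as (k0 & ->).
    exact (const_curvature_ellipse k0 X Y H). }
  assert (conv : is_ellipse X Y -> critical L (F_sqrtk L) X Y).
  { intros He. destruct (ellipse_const_curvature X Y k H He) as (k0 & ->).
    intros GX GY HG. exact (first_var_const_curvature L k0 X Y GX GY H PXY HG). }
  destruct (first_var_dilation L X Y k HL H PXY) as (HG & Zk & Zarea & Zlen & Ztot).
  (* The multiplier identity tested on the dilation gives [lambda = 0] once the constraint has
     nonzero first variation there; conversely, an ellipse is critical with [lambda = 0]. *)
  assert (under : forall G,
    first_var G (fun t u => X u + t * X u) (fun t u => Y u + t * Y u) <> 0 ->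
    (critical_under L (F_sqrtk L) G X Y <-> is_ellipse X Y)).
  { intros G HGne. split.
    - intros (lambda & Hlam). apply only.
      assert (E := Hlam _ _ HG). rewrite Zk in E.
      assert (lambda = 0) by (symmetry in E; apply Rmult_integral in E; tauto).
      intros GX GY HGxy. rewrite (Hlam GX GY HGxy). subst lambda. apply Rmult_0_l.
    - intros He. exists 0. intros GX GY HGxy. rewrite Rmult_0_l. now apply conv. }
  split; [split; assumption|]. split; [|split]; apply under.
  - rewrite Zarea. apply Rmult_integral_contrapositive_currified; [lra|].
    now apply simple_arc_area_neq_0.
  - rewrite Zlen. lra.
  - rewrite Ztot.
    assert (0 < RInt k 0 L); [|lra].
    destruct H as (_ & _ & Sk & Hk & _).
    apply RInt_gt_0; [exact HL|intros; apply Hk|].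
    intros u _. exact (is_derive_continuous k u _ (smooth1_Derive_n k 0 u Sk)).
Qed.
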